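(* The lattice kissing number of the four-dimensional cross-polytope is $\kappa_L(K_4)=40$. Moreover, it is achieved precisely by the lattices $K_4$-equivalent to $D_4^+$ (after scaling to minimum $\ell^1$-norm $1$): for a lattice $L\subset\mathbb{R}^4$ with $\min_{x\in L\setminus\{0\}}\|x\|_1=1$, one has $|\{x\in L:\|x\|_1=1\}|=40$ if and only if $L$ is $K_4$-equivalent to $\frac12 D_4^+$.
   Context: Let $\|x\|_1=\sum_{i}|x_i|$ and $K_n=\{x\in\mathbb{R}^n:\|x\|_1\leq 1\}$ (the cross-polytope). A lattice in $\mathbb{R}^n$ is the $\mathbb{Z}$-span of a basis of $\mathbb{R}^n$. The lattice kissing number $\kappa_L(K_n)$ is the maximum, over all lattices $\Lambda\subset\mathbb{R}^n$ with $\min_{x\in\Lambda\setminus\{0\}}\|x\|_1=1$, of the cardinality of $\{x\in\Lambda:\|x\|_1=1\}$. Two lattices $\Lambda_1,\Lambda_2\subset\mathbb{R}^n$ are $K_n$-equivalent if $\Lambda_1=\sigma(\Lambda_2)$ for some orthogonal linear map $\sigma$ of $\mathbb{R}^n$ with $\sigma(K_n)=K_n$, i.e., for some signed permutation $\sigma$ of the coordinates. Let $D_4=\{x\in\mathbb{Z}^4:\sum_{i=1}^4 x_i\equiv 0\pmod 2\}$ and $D_4^+=D_4\cup\left(D_4+(\tfrac12,\tfrac12,\tfrac12,\tfrac12)\right)$, which is a lattice; $\frac12 D_4^+=\{\frac12 x: x\in D_4^+\}$. *)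

(* Defs.v *)
From HB Require Import structures.
From mathcomp Require Import all_boot all_order all_algebra.
From mathcomp Require Import all_classical all_reals.

Set Implicit Arguments.
Unset Strict Implicit.
Unset Printing Implicit Defensive.

Import Order.TTheory GRing.Theory Num.Theory.

Local Open Scope classical_set_scope.
Local Open Scope card_scope.
Local Open Scope ring_scope.

Definition l1norm (R : realType) (n : nat) (x : 'rV[R]_n) : R :=
  \sum_(i < n) `|x 0 i|.

Definition crosspolytope (R : realType) (n : nat) : set 'rV[R]_n :=
  [set x | l1norm x <= 1].

Arguments crosspolytope R n : clear implicits.

(* The rows of the invertible matrix B are a basis of R^n. *)
Definition is_lattice (R : realType) (n : nat) (L : set 'rV[R]_n) : Prop :=
  exists2 B : 'M[R]_n, B \in unitmx &
    L = [set map_mx intr z *m B | z in [set: 'rV[int]_n]].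

Definition is_l1_minimum (R : realType) (n : nat) (L : set 'rV[R]_n) (m : R)
    : Prop :=
  (exists x, [/\ L x, x != 0 & l1norm x = m]) /\
  (forall x, L x -> x != 0 -> m <= l1norm x).

Definition unit_vectors (R : realType) (n : nat) (L : set 'rV[R]_n)
    : set 'rV[R]_n :=
  [set x | L x /\ l1norm x = 1].

(* k is the lattice kissing number of the cross-polytope K_n: the maximum of
   the cardinality of [unit_vectors L] over the lattices L of l1-minimum 1.
   The maximum is attained, and the bound [#<=] also excludes infinite sets. *)
Definition is_lattice_kissing_number (R : realType) (n k : nat) : Prop :=
  (exists L : set 'rV[R]_n,
     [/\ is_lattice L, is_l1_minimum L 1 & unit_vectors L #= `I_k]) /\
  (forall L : set 'rV[R]_n,
     is_lattice L -> is_l1_minimum L 1 -> unit_vectors L #<= `I_k).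

(* Linear maps of R^n are matrices acting on row vectors from the right. *)
Definition crosspolytope_equivalent (R : realType) (n : nat)
    (L1 L2 : set 'rV[R]_n) : Prop :=
  exists S : 'M[R]_n,
    [/\ S *m S^T = 1%:M,
        [set x *m S | x in crosspolytope R n] = crosspolytope R n &
        L1 = [set x *m S | x in L2]].

Definition D4 (R : realType) : set 'rV[R]_4 :=
  [set map_mx intr z | z in
     [set z : 'rV[int]_4 | (\sum_(i < 4) z 0 i = 0 %[mod 2])%Z]].

Arguments D4 R : clear implicits.

Definition D4plus (R : realType) : set 'rV[R]_4 :=
  D4 R `|` [set x + const_mx 2^-1 | x in D4 R].

Arguments D4plus R : clear implicits.

Definition half_D4plus (R : realType) : set 'rV[R]_4 :=
  [set 2^-1 *: x | x in D4plus R].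

Arguments half_D4plus R : clear implicits.

(* Main.v *)
Require Import Defs.
From mathcomp Require Import all_boot all_order all_algebra.
From mathcomp Require Import all_classical all_reals.
From mathcomp Require Import fingroup perm.
From mathcomp Require Import zify ring lra.
From mathcomp Require finmap.

Import Order.TTheory GRing.Theory Num.Theory.

Local Open Scope classical_set_scope.
Local Open Scope card_scope.
Local Open Scope ring_scope.

Set Implicit Arguments.
Unset Strict Implicit.
Unset Printing Implicit Defensive.

(** Let L be a lattice of l1-minimum 1.  Its vectors of norm 1 avoid the zero
    class of L/2L, and two of them in the same class, not equal up to sign,
    have disjoint supports: (x + y)/2 and (x - y)/2 both lie in L, and the sum
    of their norms is the sum of the max(|x_i|, |y_i|), hence at most 2, with
    equality for disjoint supports only ([cls_disjoint]).  So the 15 nonzero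
    classes of L/2L carry 15 pairs of minimal vectors plus a small excess, and
    the work is to bound that excess.

    Call a vector heavy if one of its coordinates exceeds 1/2 in absolute
    value.  Two minimal vectors that are heavy at the same coordinate differ
    by a vector of norm less than 1 up to sign, so there are at most 4 heavy
    pairs ([count_heavy]).  A light minimal vector has at least two nonzero
    coordinates; hence two light ones share a class only if they are
    (+-1/2, +-1/2) on complementary pairs of coordinates.  Given 20 pairs, at
    least 16 are light, and two of them do share a class.

    Suppose that a unit vector e_i lies in L.  In suitable coordinates the
    shared class contains (1,1,0,0)/2 and (0,0,1,1)/2, and i = 0.  Either a
    second class is shared by two light vectors, and then L contains D_4/2; or
    all 15 classes contain a light minimal vector, and the class of
    (-3,1,1,1)/4 provides a contradiction: it also contains three other
    vectors of this shape with the entry +-3/4 at each of the other positions,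
    and by [light_far_from_spike] each of the four forces a coordinate of
    the light vector to vanish ([contains_halfD4_normal_form]).

    Suppose that no e_i lies in L.  Two minimal vectors sharing a class are
    then supported on complementary pairs of coordinates, which leaves at most
    4 heavy vectors and, as a pair of coordinates supports at most one vector
    (+-1/2, +-1/2), at most 6 light ones.  If 20 pairs exist, these 6 do occur,
    and up to signs L contains all (e_i - e_j)/2 and then all vectors with two
    entries 1/4 and two entries -1/4.  Now a class cannot be shared by a heavy
    vector any more, so there are at most 15 + 3 pairs ([noaxis_A3_false]).

    Hence 20 pairs force L to contain D_4/2.  Rounding to the nearest vector
    of D_4/2 leaves for L only D_4/2, D_4^+/2 and the mirror image of the latter
    in a coordinate hyperplane ([classification]).  The first has 32 minimal
    vectors, the others have 40. *)

(** * Vectors with four coordinates *)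

Section Coordinates.
Variable R : realType.
Implicit Types x y z : 'rV[R]_4.

Definition i0 : 'I_4 := @Ordinal 4 0 isT.
Definition i1 : 'I_4 := @Ordinal 4 1 isT.
Definition i2 : 'I_4 := @Ordinal 4 2 isT.
Definition i3 : 'I_4 := @Ordinal 4 3 isT.

Lemma normr_pm (a b : R) : `|a| = b -> a = b \/ a = - b.
Proof. by case: (ger0P a) => _ <-; [left|right]; rewrite ?opprK. Qed.

Lemma forall_ord4 (P : 'I_4 -> Prop) : P i0 -> P i1 -> P i2 -> P i3 ->
  forall i, P i.
Proof.
move=> P0 P1 P2 P3 [[|[|[|[|//]]]] lt_i4].
- by rewrite (_ : Ordinal _ = i0) //; apply: val_inj.
- by rewrite (_ : Ordinal _ = i1) //; apply: val_inj.
- by rewrite (_ : Ordinal _ = i2) //; apply: val_inj.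
- by rewrite (_ : Ordinal _ = i3) //; apply: val_inj.
Qed.

Lemma sum_ord4 (V : nmodType) (F : 'I_4 -> V) :
  \sum_(i < 4) F i = F i0 + F i1 + F i2 + F i3.
Proof.
rewrite !big_ord_recl big_ord0 addr0 !addrA.
by congr (F _ + F _ + F _ + F _); apply: val_inj.
Qed.

Definition row4 (a b c d : R) : 'rV[R]_4 := \row_j nth 0 [:: a; b; c; d] j.

Lemma row4E a b c d :
  ((row4 a b c d 0 i0 = a) * (row4 a b c d 0 i1 = b) *
   (row4 a b c d 0 i2 = c) * (row4 a b c d 0 i3 = d))%type.
Proof. by rewrite !mxE. Qed.

Lemma row4_eta x : x = row4 (x 0 i0) (x 0 i1) (x 0 i2) (x 0 i3).
Proof. by apply/rowP; apply: forall_ord4; rewrite row4E. Qed.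

Lemma row4_inj a b c d a' b' c' d' :
  row4 a b c d = row4 a' b' c' d' -> [/\ a = a', b = b', c = c' & d = d'].
Proof.
move=> /rowP e; move: (e i0) (e i1) (e i2) (e i3).
by rewrite !row4E => -> -> -> ->.
Qed.

Lemma row4B a b c d a' b' c' d' :
  row4 a b c d - row4 a' b' c' d' = row4 (a - a') (b - b') (c - c') (d - d').
Proof. by apply/rowP; apply: forall_ord4; rewrite !mxE. Qed.

Lemma row4D a b c d a' b' c' d' :
  row4 a b c d + row4 a' b' c' d' = row4 (a + a') (b + b') (c + c') (d + d').
Proof. by apply/rowP; apply: forall_ord4; rewrite !mxE. Qed.

Lemma row4N a b c d : - row4 a b c d = row4 (- a) (- b) (- c) (- d).
Proof. by apply/rowP; apply: forall_ord4; rewrite !mxE. Qed.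

Lemma row4Z k a b c d :
  k *: row4 a b c d = row4 (k * a) (k * b) (k * c) (k * d).
Proof. by apply/rowP; apply: forall_ord4; rewrite !mxE. Qed.

Lemma row4_0 : 0 = row4 0 0 0 0.
Proof. by apply/rowP; apply: forall_ord4; rewrite !mxE. Qed.

(** Rewriting with this tuple evaluates a linear combination of explicit vectors. *)
Definition row4_lin := (row4B, row4D, row4N, row4Z).

Lemma l1norm4 x : l1norm x = `|x 0 i0| + `|x 0 i1| + `|x 0 i2| + `|x 0 i3|.
Proof. by rewrite /l1norm sum_ord4. Qed.

Lemma l1norm_row4 a b c d : l1norm (row4 a b c d) = `|a| + `|b| + `|c| + `|d|.
Proof. by rewrite l1norm4 !row4E. Qed.

Lemma l1norm_ge0 x : 0 <= l1norm x.
Proof. exact: sumr_ge0. Qed.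

Lemma l1norm0 : l1norm (0 : 'rV[R]_4) = 0.
Proof. by rewrite /l1norm big1 // => i _; rewrite mxE normr0. Qed.

Lemma l1norm_eq0 x : l1norm x = 0 -> x = 0.
Proof.
move=> /eqP; rewrite psumr_eq0 // => /allP x0.
by apply/rowP => i; rewrite mxE; apply/eqP; rewrite -normr_eq0; apply: x0;
   rewrite mem_index_enum.
Qed.

Lemma l1normZ k x : l1norm (k *: x) = `|k| * l1norm x.
Proof.
by rewrite /l1norm mulr_sumr; apply: eq_bigr => i _; rewrite mxE normrM.
Qed.

Lemma l1normN x : l1norm (- x) = l1norm x.
Proof. by rewrite -scaleN1r l1normZ normrN1 mul1r. Qed.

End Coordinates.

(** * Lattices modulo 2 *)

Section Lattice.
Variable R : realType.
Local Notation V := 'rV[R]_4.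
Implicit Types (x y z : V) (L : set V) (s : seq V).

(** The properties of a lattice of l1-minimum 1 that the argument uses: [c] is
    a reduction map L -> L/2L, seen as a labelling of vectors by the 16
    elements of F_2^4. *)
Definition admissible L (c : V -> 'rV['F_2]_4) :=
  [/\ L 0, forall x y, L x -> L y -> L (x - y),
      forall x, L x -> x != 0 -> 1 <= l1norm x &
      forall x y, L x -> L y -> (c x = c y <-> L (2^-1 *: (x - y)))].

Variables (L : set V) (c : V -> 'rV['F_2]_4).
Hypothesis adm : admissible L c.

Lemma lat0 : L 0. Proof. by case: adm. Qed.
Lemma latB x y : L x -> L y -> L (x - y).
Proof. by case: adm => _ + _ _; apply. Qed.
Lemma latN x : L x -> L (- x).
Proof. by rewrite -sub0r; apply: latB; apply: lat0. Qed.
Lemma latD x y : L x -> L y -> L (x + y).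
Proof. by move=> Lx Ly; rewrite -[y]opprK; apply: latB => //; apply: latN. Qed.

Lemma latMn x n : L x -> L (x *+ n).
Proof. by move=> Lx; elim: n => [|n IH]; [exact: lat0|rewrite mulrS; exact: latD]. Qed.

Lemma latMz x (m : int) : L x -> L (x *~ m).
Proof. by move=> Lx; case: m => n; [exact: latMn|apply: latN; exact: latMn]. Qed.

Lemma lat_small x : L x -> l1norm x < 1 -> x = 0.
Proof.
move=> Lx; apply: contraTeq => x0; rewrite -leNgt.
by case: adm => _ _ + _; apply.
Qed.

Lemma latN_eq x : L (- x) <-> L x.
Proof. by split=> [/latN|/latN //]; rewrite opprK. Qed.

Lemma cls_half x y : L x -> L y -> c x = c y -> L (2^-1 *: (x - y)).
Proof. by move=> Lx Ly; case: adm => _ _ _ h; move/h; apply. Qed.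

Lemma half_cls x y : L x -> L y -> L (2^-1 *: (x - y)) -> c x = c y.
Proof. by move=> Lx Ly h; case: adm => _ _ _ ->. Qed.

Lemma cls_halfD x y : L x -> L y -> c x = c y -> L (2^-1 *: (x + y)).
Proof.
move=> Lx Ly /(cls_half Lx Ly) h; suff -> : 2^-1 *: (x + y) = 2^-1 *: (x - y) + y.
  exact: latD.
by apply/rowP=> i; rewrite !mxE; field.
Qed.

Lemma halfD_cls x y : L x -> L y -> L (2^-1 *: (x + y)) -> c x = c y.
Proof.
move=> Lx Ly h; apply: half_cls => //.
suff -> : 2^-1 *: (x - y) = 2^-1 *: (x + y) - y by exact: latB.
by apply/rowP=> i; rewrite !mxE; field.
Qed.

Lemma clsN x : L x -> c (- x) = c x.
Proof.
move=> Lx; apply: halfD_cls => //; first exact: latN.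
by rewrite addNr scaler0; exact: lat0.
Qed.

Definition min_vector x := L x /\ l1norm x = 1.

Lemma min_vectorN x : min_vector x -> min_vector (- x).
Proof. by case=> Lx Nx; split; [exact: latN | rewrite l1normN]. Qed.

Lemma min_vector_cls x : min_vector x -> c x <> c 0.
Proof.
case=> Lx Nx /(cls_half Lx lat0); rewrite subr0 => Lh.
have /lat_small : L (2^-1 *: x) by [].
rewrite l1normZ Nx gtr0_norm ?invr_gt0 // mulr1 invf_lt1 // ltr1n => /(_ isT).
move/eqP; rewrite scaler_eq0 invr_eq0 pnatr_eq0 /= => /eqP x0.
by move: Nx; rewrite x0 l1norm0 => /eqP; rewrite eq_sym oner_eq0.
Qed.

(** Both x and y have more than half of their mass at coordinate i, where it
    cancels in x - y. *)
Lemma large_coordinate_eq x y i : min_vector x -> min_vector y ->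
  2^-1 < x 0 i -> 2^-1 < y 0 i -> x = y.
Proof.
move=> [Lx Nx] [Ly Ny] xi yi; apply/eqP; rewrite -subr_eq0; apply/eqP.
apply: lat_small; first exact: latB.
have n1 : `|x 0 i - y 0 i| < `|x 0 i| + `|y 0 i| - 1.
  rewrite (gtr0_norm (_ : 0 < x 0 i)); last lra.
  rewrite (gtr0_norm (_ : 0 < y 0 i)); last lra.
  by case: (ger0P (x 0 i - y 0 i)) => _; lra.
have : l1norm (x - y) < l1norm x + l1norm y - 1; last by rewrite Nx Ny; lra.
rewrite /l1norm (bigD1 i) //= [X in _ < X + _ - 1](bigD1 i) //=.
rewrite [X in _ < _ + X - 1](bigD1 i) //=.
have : \sum_(j < 4 | j != i) `|(x - y) 0 j| <=
   \sum_(j < 4 | j != i) `|x 0 j| + \sum_(j < 4 | j != i) `|y 0 j|.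
  by rewrite -big_split; apply: ler_sum => j _; rewrite !mxE ler_normB.
by rewrite !mxE; lra.
Qed.

(** The vectors (x + y)/2 and (x - y)/2 of L are nonzero, so their norms sum to
    at least 2; but |x_i + y_i| + |x_i - y_i| <= 2 (|x_i| + |y_i|), strictly when
    x_i and y_i are both nonzero. *)
Lemma cls_disjoint x y : min_vector x -> min_vector y -> c x = c y -> x <> y -> x <> - y ->
  forall i, x 0 i = 0 \/ y 0 i = 0.
Proof.
move=> [Lx Nx] [Ly Ny] cxy nxy nxNy i.
have half_ge1 z : L (2^-1 *: z) -> z <> 0 -> 2 <= l1norm z.
  move=> Lz z0; rewrite leNgt; apply/negP => ltz; apply: z0.
  have := lat_small Lz; rewrite l1normZ gtr0_norm ?invr_gt0 //.
  rewrite ltr_pdivrMl // mulr1 => /(_ ltz)/eqP.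
  by rewrite scaler_eq0 invr_eq0 pnatr_eq0 => /eqP.
have /half_ge1 h1 := cls_half Lx Ly cxy.
have /half_ge1 h2 := cls_halfD Lx Ly cxy.
have {}h1 : 2 <= l1norm (x - y) by apply: h1 => /eqP; rewrite subr_eq0 => /eqP.
have {}h2 : 2 <= l1norm (x + y) by apply: h2 => /eqP; rewrite addr_eq0 => /eqP.
pose F j := 2 * (`|x 0 j| + `|y 0 j|) - (`|x 0 j - y 0 j| + `|x 0 j + y 0 j|).
have F_ge0 j : 0 <= F j.
  by move: (ler_normB (x 0 j) (y 0 j)) (ler_normD (x 0 j) (y 0 j)); rewrite /F; lra.
have SF : \sum_(j < 4) F j <= 0.
  rewrite /F big_split /= sumrN -mulr_sumr !big_split /=.
  have -> : \sum_(j < 4) `|x 0 j - y 0 j| = l1norm (x - y).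
    by apply: eq_bigr => j _; rewrite !mxE.
  have -> : \sum_(j < 4) `|x 0 j + y 0 j| = l1norm (x + y).
    by apply: eq_bigr => j _; rewrite !mxE.
  rewrite -[X in 2 * (X + _)]/(l1norm x) -[X in 2 * (_ + X)]/(l1norm y) Nx Ny.
  by lra.
have Fi : F i = 0.
  apply/eqP; rewrite eq_le F_ge0 andbT; apply: le_trans SF.
  by rewrite (bigD1 i) //= lerDl sumr_ge0.
move: Fi; rewrite /F.
have [->|x0] := eqVneq (x 0 i) 0; first by left.
have [->|y0] := eqVneq (y 0 i) 0; first by right.
move: x0 y0; move: (x 0 i) (y 0 i) => a b.
rewrite !neq_lt => /orP[] ha /orP[] hb.
all: rewrite ?(ltr0_norm ha) ?(gtr0_norm ha) ?(ltr0_norm hb) ?(gtr0_norm hb).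
all: by case: (ger0P (a - b)); case: (ger0P (a + b)); lra.
Qed.

End Lattice.

(** * Counting by classes *)

Section Fibers.
Variables (V : eqType) (T : finType) (f : V -> T).

Lemma sum_fibers (s : seq V) (B : pred V) :
  count B s = (\sum_t count (fun x => B x && (f x == t)) s)%N.
Proof.
elim: s => [|x s IH] /=; first by rewrite big1.
rewrite big_split /= -IH; congr (_ + _)%N.
rewrite (bigD1 (f x)) //= eqxx andbT big1 ?addn0 // => t.
by rewrite eq_sym => /negPf->; rewrite andbF.
Qed.

(** [Z] is a set of forbidden values and [B] holds on the fibers with two
    elements.  A fiber with n <= 2 elements, b of which satisfy [B], has
    2 n <= 2 + b. *)
Lemma fiber_count (Z : {set T}) (B : pred V) (s : seq V) :
  uniq s -> {in s, forall x, f x \notin Z} ->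
  {in s &, forall x y, x != y -> f x = f y -> B x} ->
  {in s & &, forall x y z, uniq [:: x; y; z] -> f x = f y -> f x <> f z} ->
  (2 * size s <= 2 * #|~: Z| + count B s)%N.
Proof.
move=> us sZ sB s3; rewrite -(count_predT s).
rewrite (sum_fibers s predT) (sum_fibers s B) big_distrr /=.
rewrite -sum1_card big_distrr /= [in X in (_ <= X + _)%N]big_mkcond -big_split /=.
apply: leq_sum => t _.
pose l := [seq x <- s | f x == t].
have -> : count (fun x => f x == t) s = size l by rewrite size_filter.
have -> : count (fun x => B x && (f x == t)) s = count B l.
  by rewrite count_filter; apply: eq_count.
have ul : uniq l by rewrite filter_uniq.
have ls x : x \in l -> x \in s /\ f x = t.
  by rewrite mem_filter => /andP[/eqP].
rewrite inE; case: (boolP (t \in Z)) => [tZ|_] /=.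
  suff -> : l = [::] by [].
  case: (l) (ls) => [//|x l'] /(_ x (mem_head _ _))[xs xt].
  by have := sZ x xs; rewrite xt tZ.
case: (l) ul ls => [//|x [//|y [|z l']]] ul ls.
- have [[xs xt] [ys yt]] : (x \in s /\ f x = t) /\ (y \in s /\ f y = t).
    by split; apply: ls; rewrite !inE eqxx ?orbT.
  move: ul; rewrite /= inE andbT => nxy.
  rewrite (sB x y) ?(sB y x) //; first by rewrite eq_sym.
  + by rewrite xt yt.
  + by rewrite xt yt.
- have [[xs xt] [[ys yt] [zs zt]]] :
     (x \in s /\ f x = t) /\ (y \in s /\ f y = t) /\ (z \in s /\ f z = t).
    by split; [|split]; apply: ls; rewrite !inE eqxx ?orbT.
  case: (s3 x y z) => //; last by rewrite xt zt.
  + apply: (subseq_uniq (s2 := [:: x, y, z & l'])) => //.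
    by rewrite /= !eqxx sub0seq.
  + by rewrite xt yt.
Qed.

End Fibers.

(** * Signed permutations of the coordinates *)

Section SignedPermutation.
Variable R : realType.
Local Notation V := 'rV[R]_4.
Implicit Types (x y z : V) (L : set V) (s : seq V).
Variables (p : 'S_4) (e : 'I_4 -> R).
Hypothesis e1 : forall i, e i * e i = 1.

Definition sperm (p : 'S_4) (e : 'I_4 -> R) x : V := \row_j (e j * x 0 (p j)).

Definition sperm_inv := sperm (p^-1)%g (fun i => e ((p^-1)%g i)).

Lemma spermK : cancel (sperm p e) sperm_inv.
Proof. by move=> x; apply/rowP => j; rewrite !mxE mulrA e1 mul1r permKV. Qed.

Lemma sperm_invK : cancel sperm_inv (sperm p e).
Proof. by move=> x; apply/rowP => j; rewrite !mxE permK mulrA e1 mul1r. Qed.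

Lemma spermB x y : sperm p e (x - y) = sperm p e x - sperm p e y.
Proof. by apply/rowP => j; rewrite !mxE mulrBr. Qed.

Lemma spermZ k x : sperm p e (k *: x) = k *: sperm p e x.
Proof. by apply/rowP => j; rewrite !mxE mulrCA. Qed.

Lemma sperm0 : sperm p e 0 = 0.
Proof. by apply/rowP => j; rewrite !mxE mulr0. Qed.

Lemma norm_sign i : `|e i| = 1.
Proof.
apply/eqP; rewrite -(@eqrXn2 _ 2) ?expr1n ?normr_ge0 //.
by rewrite -normrX expr2 e1 normr1.
Qed.

Lemma l1norm_sperm x : l1norm (sperm p e x) = l1norm x.
Proof.
rewrite /l1norm [RHS](reindex_inj (@perm_inj _ p)) /=.
by apply: eq_bigr => j _; rewrite mxE normrM norm_sign mul1r.
Qed.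

End SignedPermutation.

(** * Supports and heavy vectors *)

Section Families.
Variable R : realType.
Local Notation V := 'rV[R]_4.
Implicit Types (x y z w : V) (s : seq V).

Definition supp x := [set i : 'I_4 | x 0 i != 0]%SET.
Definition heavy x := [exists i : 'I_4, 2^-1 < `|x 0 i|].

Lemma heavyPn x : ~~ heavy x -> forall i, `|x 0 i| <= 2^-1.
Proof. by move=> /existsPn h i; rewrite leNgt; apply: h. Qed.

Lemma memsupp x i : (i \in supp x) = (x 0 i != 0).
Proof. by rewrite inE. Qed.

Lemma supp_out x i : i \notin supp x -> x 0 i = 0.
Proof. by rewrite inE negbK => /eqP. Qed.

Lemma l1norm_supp x : l1norm x = \sum_(i in supp x) `|x 0 i|.
Proof.
rewrite /l1norm [RHS]big_mkcond; apply: eq_bigr => i _.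
by case: ifPn => // /supp_out ->; rewrite normr0.
Qed.

(** With at most one nonzero coordinate the norm would be at most 1/2. *)
Lemma supp_light x : l1norm x = 1 -> ~~ heavy x -> (2 <= #|supp x|)%N.
Proof.
move=> Nx /heavyPn hx; rewrite -(ler_nat R).
have : \sum_(i in supp x) `|x 0 i| <= \sum_(i in supp x) 2^-1 by apply: ler_sum.
by rewrite -l1norm_supp Nx sumr_const -[_ *+ #|_|]mulr_natl; lra.
Qed.

Lemma supp_half x : l1norm x = 1 -> ~~ heavy x -> #|supp x| = 2%N ->
  forall i, i \in supp x -> `|x 0 i| = 2^-1.
Proof.
move=> Nx /heavyPn hx c2 i xi.
have := Nx; rewrite l1norm_supp (bigD1 i) //=.
have : \sum_(j in supp x | j != i) `|x 0 j| <= \sum_(j in supp x | j != i) 2^-1.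
  by apply: ler_sum.
have c1 : #|[pred j | (j \in supp x) && (j != i)]| = 1%N.
  have := cardsD1 i (supp x); rewrite xi c2 => -[c1].
  by rewrite [RHS]c1; apply: eq_card => j; rewrite !inE andbC.
by rewrite sumr_const c1 mulr1n; have := hx i; lra.
Qed.

Section Fixed.
Variables (L : set V) (c : V -> 'rV['F_2]_4).
Hypothesis adm : admissible L c.
Notation min_vector := (min_vector L).

(** One minimal vector from each of several pairs {x, -x}: this counts minimal
    vectors up to sign. *)
Definition antipode_free s :=
  [/\ uniq s, {in s, forall x, min_vector x} & {in s &, forall x y, x <> - y}].

Lemma antipode_free_filter (a : pred V) s : antipode_free s -> antipode_free [seq x <- s | a x].
Proof.
case=> us sU sN; split; first exact: filter_uniq.
  by move=> x; rewrite mem_filter => /andP[_]; apply: sU.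
by move=> x y; rewrite !mem_filter => /andP[_ xs] /andP[_ ys]; apply: sN.
Qed.

Lemma heavy_coordinate_eq x y i : min_vector x -> min_vector y ->
  2^-1 < `|x 0 i| -> 2^-1 < `|y 0 i| -> x = y \/ x = - y.
Proof.
move=> Ux Uy; have UNx := min_vectorN adm Ux; have UNy := min_vectorN adm Uy.
case: (ger0P (x 0 i)) => [x0|x0]; case: (ger0P (y 0 i)) => [y0|y0] hx hy.
- by left; apply: (large_coordinate_eq adm (i := i)).
- by right; apply: (large_coordinate_eq adm (i := i)) => //; rewrite mxE.
- by right; rewrite -[x]opprK; congr (- _);
    apply: (large_coordinate_eq adm (i := i)) => //; rewrite mxE.
- left; rewrite -[x]opprK -[y]opprK; congr (- _).
  by apply: (large_coordinate_eq adm (i := i)) => //; rewrite mxE.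
Qed.

(** A heavy vector is determined up to sign by its heavy coordinate. *)
Lemma count_heavy s : antipode_free s -> (count heavy s <= 4)%N.
Proof.
move=> /(antipode_free_filter heavy)[us sU sN]; rewrite -size_filter.
pose idx x : 'I_4 := odflt ord0 [pick i | 2^-1 < `|x 0 i|].
have idxP x : x \in [seq x <- s | heavy x] -> 2^-1 < `|x 0 (idx x)|.
  rewrite mem_filter => /andP[/existsP[i xi] _]; rewrite /idx.
  by case: pickP => //= /(_ i); rewrite xi.
rewrite -(size_map idx) -[X in (_ <= X)%N](card_ord 4) cardE.
apply: uniq_leq_size => [|i _]; last by rewrite mem_enum.
rewrite map_inj_in_uniq // => x y xs ys exy.
have := heavy_coordinate_eq (sU x xs) (sU y ys) (idxP x xs).
by rewrite exy => /(_ (idxP y ys))[// | /sN]; move=> /(_ xs ys).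
Qed.

Lemma collision s x y : antipode_free s -> x \in s -> y \in s -> x != y -> c x = c y ->
  [/\ min_vector x, min_vector y & (supp x \subset ~: supp y)%SET].
Proof.
move=> [us sU sN] xs ys nxy cxy; split; [exact: sU | exact: sU |].
have h := cls_disjoint adm (sU x xs) (sU y ys) cxy (elimN eqP nxy) (sN x y xs ys).
apply/fintype.subsetP => i; rewrite !inE negbK => xi.
by case: (h i) => [x0|->]; rewrite ?eqxx //; rewrite x0 eqxx in xi.
Qed.

Lemma disjoint_card2 (A B : {set 'I_4}) : (A \subset ~: B)%SET ->
  (2 <= #|A|)%N -> (2 <= #|B|)%N -> [/\ #|A| = 2%N, #|B| = 2%N & B = (~: A)%SET].
Proof.
move=> dAB cA cB; have sub : B \subset (~: A)%SET by rewrite -finset.setCS finset.setCK.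
have cAC := cardsC A; rewrite card_ord in cAC.
have le := subset_leq_card sub.
by split; [lia | lia | apply/eqP; rewrite eqEcard sub; lia].
Qed.

Lemma disjoint_card3 (A B C : {set 'I_4}) :
  (A \subset ~: B)%SET -> (A \subset ~: C)%SET -> (B \subset ~: C)%SET ->
  (2 <= #|A|)%N -> (2 <= #|B|)%N -> (2 <= #|C|)%N -> False.
Proof.
move=> dAB dAC dBC cA cB cC.
have [_ _ eB] := disjoint_card2 dAB cA cB.
have [_ _ eC] := disjoint_card2 dAC cA cC.
by move: dBC cB; rewrite eB eC finset.setCK => /finset.setIidPl <-; rewrite finset.setIC finset.setICr cards0.
Qed.

(** The lattice D_4/2. *)
Definition halfD4 x := (forall i, 2 * x 0 i \is a Num.int) /\
  \sum_i x 0 i \is a Num.int.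

Definition contains_halfD4 := forall x, halfD4 x -> L x.

(** Vectors of the same class have disjoint supports, and three supports of
    cardinality at least 2 do not fit in four coordinates. *)
Lemma antipode_free_count (Z : {set 'rV['F_2]_4}) (B : pred V) s :
  antipode_free s -> {in s, forall x, (2 <= #|supp x|)%N} ->
  {in s, forall x, c x \notin Z} ->
  {in s &, forall x y, x != y -> c x = c y -> B x} ->
  (2 * size s <= 2 * #|~: Z| + count B s)%N.
Proof.
move=> Fs s2 sZ sB; have [us sU sN] := Fs.
apply: (fiber_count us sZ) => // x y z xs ys zs.
rewrite /= !inE negb_or !andbT => /andP[/andP[nxy nxz] nyz] cxy cxz.
have [_ _ d1] := collision Fs xs ys nxy cxy.
have [_ _ d2] := collision Fs xs zs nxz cxz.
have [_ _ d3] := collision Fs ys zs nyz (etrans (esym cxy) cxz).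
exact: (disjoint_card3 d1 d2 d3 (s2 _ xs) (s2 _ ys) (s2 _ zs)).
Qed.

Lemma class_count t s : antipode_free s -> {in s, forall x, (2 <= #|supp x|)%N} ->
  (count (fun x => c x == t) s <= 2)%N.
Proof.
move=> Fs s2; rewrite -size_filter.
have [ul _ _] := antipode_free_filter (fun x => c x == t) Fs.
have ls x : x \in [seq x <- s | c x == t] -> x \in s /\ c x = t.
  by rewrite mem_filter => /andP[/eqP].
case E : [seq x <- s | c x == t] ul ls => [//|x [//|y [//|z l]]] ul ls.
have [[xs xt] [[ys yt] [zs zt]]] :
   (x \in s /\ c x = t) /\ (y \in s /\ c y = t) /\ (z \in s /\ c z = t).
  by split; [|split]; apply: ls; rewrite !inE eqxx ?orbT.
move: ul; rewrite /= !inE !negb_or => /andP[/and3P[nxy nxz _] /andP[/andP[nyz _] _]].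
have [_ _ d1] := collision Fs xs ys nxy (etrans xt (esym yt)).
have [_ _ d2] := collision Fs xs zs nxz (etrans xt (esym zt)).
have [_ _ d3] := collision Fs ys zs nyz (etrans yt (esym zt)).
by case: (disjoint_card3 d1 d2 d3 (s2 _ xs) (s2 _ ys) (s2 _ zs)).
Qed.

Lemma light_count s : antipode_free s -> (size s <= 4 + size [seq x <- s | ~~ heavy x])%N.
Proof.
move=> /count_heavy h4; rewrite size_filter -(count_predC heavy s).
by rewrite leq_add2r.
Qed.

Lemma card_classes : #|[set: 'rV['F_2]_4]%SET| = 16%N.
Proof. by rewrite cardsT card_mx card_Fp. Qed.

End Fixed.
End Families.

(** The situation is invariant under signed permutations. *)

Section Transport.
Variable R : realType.
Local Notation V := 'rV[R]_4.
Variables (L : set V) (c : V -> 'rV['F_2]_4).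
Hypothesis adm : admissible L c.
Variables (p : 'S_4) (e : 'I_4 -> R).
Hypothesis e1 : forall i, e i * e i = 1.
Local Notation T := (sperm p e).
Local Notation L' := (fun x => L (T x)).

Lemma admissible_sperm : admissible L' (c \o T).
Proof.
case: adm => L0 LB Lmin Lc; split => /=.
- by rewrite (sperm0 p e).
- by move=> x y Lx Ly; rewrite spermB; apply: LB.
- move=> x Lx x0; rewrite -(l1norm_sperm p e1); apply: Lmin => //.
  apply: contra_neq x0 => Tx0; rewrite -[x](spermK p e1) Tx0. by apply/rowP=> j; rewrite !mxE mulr0.
- by move=> x y Lx Ly; rewrite spermZ spermB; apply: Lc.
Qed.

Lemma antipode_free_sperm s : antipode_free L s -> antipode_free L' (map (sperm_inv p e) s).
Proof.
move=> [us sU sN]; have K := sperm_invK p e1; split.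
- by rewrite map_inj_uniq //; apply: can_inj K.
- move=> _ /mapP[x xs ->]; case: (sU x xs) => Lx Nx; split; first by rewrite /= K.
  by rewrite -(l1norm_sperm p e1) K.
- move=> _ _ /mapP[x xs ->] /mapP[y ys ->] E; apply: (sN x y) => //.
  by rewrite -[x]K E -[- sperm_inv p e y]scaleN1r spermZ K scaleN1r.
Qed.

Lemma contains_halfD4_sperm : contains_halfD4 L' -> contains_halfD4 L.
Proof.
move=> H x [xi xs]; rewrite -(sperm_invK p e1 x).
have sgn i : e i = 1 \/ e i = -1.
  have /eqP := e1 i; rewrite -expr2 sqrf_eq1 => /orP[]/eqP; [by left|by right].
suff : halfD4 (sperm_inv p e x) by exact: (H (sperm_inv p e x)).
split => [i|].
  rewrite mxE mulrCA; case: (sgn ((p^-1)%g i)) => ->; rewrite ?mul1r ?mulN1r ?rpredN //.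
rewrite -[X in X \is a _](subrK (\sum_i x 0 i)) rpredD //.
rewrite [X in _ - X](reindex_inj (@perm_inj _ (p^-1)%g)) /= -sumrB rpred_sum // => i _.
rewrite mxE; case: (sgn ((p^-1)%g i)) => ->; first by rewrite mul1r subrr rpred0.
by rewrite mulN1r -opprD -mulr2n -mulr_natl rpredN xi.
Qed.

End Transport.

(** * A unit vector in the lattice *)

Ltac row4_eq := rewrite ?row4_lin; congr (row4 _ _ _ _); field.
Ltac lat H := apply: (eq_ind _ _ H); row4_eq.

Section AxisNormalForm.
Variable R : realType.
Local Notation V := 'rV[R]_4.
Implicit Types (x y z w : V) (s : seq V).
Variables (L : set V) (c : V -> 'rV['F_2]_4).
Hypothesis adm : admissible L c.

Lemma latZz x (m : int) : L x -> L (m%:~R *: x).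
Proof. by rewrite scaler_int; apply: (latMz adm). Qed.

Lemma contains_halfD4_gen :
  L (row4 1 0 0 0) -> L (row4 2^-1 2^-1 0 0) -> L (row4 2^-1 0 2^-1 0) ->
  L (row4 2^-1 0 0 2^-1) -> contains_halfD4 L.
Proof.
move=> L0 L1 L2 L3 x [xi]; rewrite sum_ord4 => /intrP[M eM].
have /intrP[m1 e1] := xi i1; have /intrP[m2 e2] := xi i2.
have /intrP[m3 e3] := xi i3.
have H := latD adm (latZz (M - m1 - m2 - m3) L0) (latD adm (latZz m1 L1)
  (latD adm (latZz m2 L2) (latZz m3 L3))).
move: H; rewrite [x in L x -> _](_ : _ = x) //.
rewrite [RHS]row4_eta !row4_lin !intrB -eM -e1 -e2 -e3.
by congr (row4 _ _ _ _); lra.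
Qed.

(** The normal form: e_0 lies in L, and the half vectors h and k, supported on
    complementary pairs of coordinates, share a class. *)
Hypotheses (L0 : L (row4 1 0 0 0)) (Lh : L (row4 2^-1 2^-1 0 0))
  (Lk : L (row4 0 0 2^-1 2^-1))
  (chk : c (row4 2^-1 2^-1 0 0) = c (row4 0 0 2^-1 2^-1)).
Notation h := (row4 2^-1 2^-1 0 0 : V).
Notation k := (row4 0 0 2^-1 2^-1 : V).

Lemma lat_axis1 : L (row4 0 1 0 0). Proof. by lat (latB adm (latD adm Lh Lh) L0). Qed.
Lemma lat_rootm : L (row4 2^-1 (- 2^-1) 0 0). Proof. by lat (latB adm Lh lat_axis1). Qed.
Lemma lat_quarter_pppp : L (row4 4^-1 4^-1 4^-1 4^-1).
Proof. by lat (cls_halfD adm Lh Lk chk). Qed.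
Lemma lat_quarter_ppmm : L (row4 4^-1 4^-1 (- 4^-1) (- 4^-1)).
Proof. by lat (cls_half adm Lh Lk chk). Qed.

(** The vectors x and y are (+-1/2, +-1/2) on complementary pairs of
    coordinates.  For the pairs {0,2}, {1,3} and {0,3}, {1,2}, adding e_0, e_1
    and h to x and y produces generators of D_4/2.  For {0,1}, {2,3}, the class
    differs from that of h and k, so x and y are up to sign (1,-1,0,0)/2 and
    (0,0,1,-1)/2, and (x + y)/2 together with (h + k)/2 gives (1,0,1,0)/2. *)
Lemma second_collision x y : min_vector L x -> min_vector L y -> ~~ heavy x -> ~~ heavy y ->
  (supp x \subset ~: supp y)%SET -> x 0 i0 != 0 -> c x = c y -> c x <> c h ->
  contains_halfD4 L.
Proof.
move=> [Lx Nx] [Ly Ny] hx hy dxy x0 cxy cxh.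
have dyx : (supp y \subset ~: supp x)%SET by rewrite -finset.setCS finset.setCK.
have [cx cy ey] := disjoint_card2 dxy (supp_light Nx hx) (supp_light Ny hy).
have xy i : `|x 0 i| = 2^-1 /\ y 0 i = 0 \/ x 0 i = 0 /\ `|y 0 i| = 2^-1.
  case: (boolP (i \in supp x)) => xi; [left|right]; split.
  - exact: supp_half.
  - by apply: supp_out; rewrite ey inE xi.
  - exact: supp_out.
  - by apply: supp_half => //; rewrite ey inE.
have L1 := lat_axis1; clear cx cy ey dxy dyx hx hy.
move: Nx Ny Lx Ly cxy cxh x0; rewrite (row4_eta x) (row4_eta y) !l1norm_row4 !row4E.
case: (xy i0) => [][]; last by move=> ->; rewrite eqxx.
move=> X0 -> + + + + + + _.
have h13 : L (row4 2^-1 0 2^-1 0) -> L (row4 0 2^-1 0 2^-1) -> contains_halfD4 L.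
  move=> H1 H2; apply: contains_halfD4_gen => //.
  by lat (latB adm (latD adm H2 Lh) L1).
have h14 : L (row4 2^-1 0 0 2^-1) -> L (row4 0 2^-1 2^-1 0) -> contains_halfD4 L.
  move=> H1 H2; apply: contains_halfD4_gen => //.
  by lat (latB adm (latD adm H2 Lh) L1).
have h12 : L (row4 0 0 2^-1 (- 2^-1)) ->
   c (row4 2^-1 (- 2^-1) 0 0) = c (row4 0 0 2^-1 (- 2^-1)) -> contains_halfD4 L.
  move=> Lk' e; have H1 := cls_halfD adm Lh Lk chk.
  have H2 := cls_halfD adm lat_rootm Lk' e.
  apply: contains_halfD4_gen => //; first by lat (latD adm H1 H2).
  by lat (latB adm (latD adm H1 H2) Lk').
case: (xy i1) (xy i2) (xy i3)
  => [][X1 Y1][][X2 Y2][][X3 Y3]; rewrite ?X0 ?X1 ?X2 ?X3 ?Y1 ?Y2 ?Y3 ?normr0;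
  move=> Nx Ny; try (exfalso; lra); move=> Lx Ly cxy cxh.
- have {cxy cxh}[cy cyh] : c (row4 2^-1 (- 2^-1) 0 0) = c (row4 0 0 (y 0 i2) (y 0 i3)) /\
      c (row4 0 0 (y 0 i2) (y 0 i3)) <> c h.
    rewrite -cxy; split=> //; move: cxh; have cN z := clsN adm (x := z).
    case: (normr_pm X0) => ->; case: (normr_pm X1) => -> //.
    + by rewrite -(cN _ lat_rootm) row4N oppr0 opprK.
    + by case; rewrite -(cN h Lh) row4N oppr0.
  move: Ly cy cyh; have cN z := clsN adm (x := z).
  case: (normr_pm Y2) => ->; case: (normr_pm Y3) => -> Ly cy; rewrite -?chk //.
  + by move=> _; apply: h12.
  + by move=> _; move/(latN adm): (Ly) (cy); rewrite -(cN _ Ly) row4N oppr0 opprK; apply: h12.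
  + by case; rewrite -(cN _ Ly) row4N oppr0 opprK chk.
- apply: h13; [move: Lx; case: (normr_pm X0) => ->; case: (normr_pm X2) => ->
    | move: Ly; case: (normr_pm Y1) => ->; case: (normr_pm Y3) => ->] => H;
  by first [exact: H | lat (latN adm H) | lat (latD adm H L0) | lat (latB adm L0 H)
           | lat (latD adm H L1) | lat (latB adm L1 H)].
- apply: h14; [move: Lx; case: (normr_pm X0) => ->; case: (normr_pm X3) => ->
    | move: Ly; case: (normr_pm Y1) => ->; case: (normr_pm Y2) => ->] => H;
  by first [exact: H | lat (latN adm H) | lat (latD adm H L0) | lat (latB adm L0 H)
           | lat (latD adm H L1) | lat (latB adm L1 H)].
Qed.

Lemma abs_shift4 (t r : R) : `|t| <= 2^-1 -> r = 4^-1 \/ r = - 4^-1 ->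
  `|t - r| + `|t + r| <= 2^-1 + `|t|.
Proof.
move=> + [] ->; case: (ger0P t) => t0; do 2 case: ger0P => ?; lra.
Qed.

Lemma abs_shift34 (t r : R) : `|t| <= 2^-1 -> r = 3 / 4 \/ r = - (3 / 4) ->
  `|t - r| + `|t + r| = 3 / 2.
Proof.
move=> + [] ->; case: (ger0P t) => t0; do 2 case: ger0P => ?; lra.
Qed.

(** The vectors (z - w)/2 and (z + w)/2 are nonzero and lie in L, so the norms
    of z - w and z + w sum to at least 4.  Coordinatewise this sum is
    2 max(|z_j|, |w_j|), which for a light z is 3/2 at i and at most 1/2 + |z_j|
    elsewhere: the total is at most 4 - |z_i|. *)
Lemma light_far_from_spike z w i : min_vector L z -> ~~ heavy z -> L w -> c z = c w ->
  (`|w 0 i| = 3 / 4 /\ forall j, j != i -> `|w 0 j| = 4^-1) -> z 0 i = 0.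
Proof.
move=> [Lz Nz] /heavyPn hz Lw czw [wi wj].
have Nw : l1norm w = 3 / 2.
  rewrite /l1norm (bigD1 i) //= wi (eq_bigr (fun=> 4^-1)) //.
  rewrite sumr_const cardC1 card_ord /= -mulr_natl; lra.
have big2 v : L (2^-1 *: v) -> v != 0 -> 2 <= l1norm v.
  move=> Lv v0; case: adm => _ _ /(_ _ Lv) + _.
  rewrite scaler_eq0 invr_eq0 pnatr_eq0 /= => /(_ v0).
  by rewrite l1normZ gtr0_norm ?invr_gt0 //; lra.
have B1 : 2 <= l1norm (z - w).
  apply: big2; first exact: (cls_half adm).
  by rewrite subr_eq0; apply: contra_eq_neq Nz => ->; rewrite Nw; apply/eqP; lra.
have B2 : 2 <= l1norm (z + w).
  apply: big2; first exact: (cls_halfD adm).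
  by rewrite addr_eq0; apply: contra_eq_neq Nz => ->; rewrite l1normN Nw; apply/eqP; lra.
have : l1norm (z - w) + l1norm (z + w) <= 3 / 2 + (3 / 2 + (l1norm z - `|z 0 i|)).
  rewrite /l1norm -big_split (bigD1 i) //= !mxE abs_shift34 //; last exact: normr_pm.
  rewrite lerD2l [X in _ <= _ + (X - _)](bigD1 i) //= addrAC subrr add0r.
  have -> : 3 / 2 = \sum_(j < 4 | j != i) 2^-1 :> R.
    by rewrite sumr_const cardC1 card_ord /= -mulr_natl; lra.
  rewrite -big_split; apply: ler_sum => j ji; rewrite !mxE.
  by apply: abs_shift4 => //; apply: normr_pm; apply: wj.
move=> H; apply/eqP; rewrite -normr_eq0 eq_le normr_ge0 andbT.
move: H B1 B2; rewrite Nz; lra.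
Qed.

(** If h and k are in the only class shared by light vectors, then at least
    16 - 1 classes, thus all nonzero ones, contain a light vector.  For the
    class of e_0 and e_1 this is up to sign (0,0,1,-1)/2.  It follows that e_2 and
    e_3 lie in L and that the four vectors w0, w1, w2, w3 below share a class;
    no light vector can be in it. *)
Lemma contains_halfD4_normal_form s : antipode_free L s -> (20 <= size s)%N ->
  contains_halfD4 L.
Proof.
move=> Fs s20; pose NH := [seq x <- s | ~~ heavy x].
have FNH : antipode_free L NH by apply: antipode_free_filter.
have NH16 : (16 <= size NH)%N by have := light_count adm Fs; rewrite -/NH; lia.
have [usNH uNH sgNH] := FNH.
have lNH x : x \in NH -> ~~ heavy x by rewrite mem_filter => /andP[].
have s2NH : {in NH, forall x, (2 <= #|supp x|)%N}.
  by move=> x xs; have [_ Nx] := uNH x xs; apply: supp_light => //; apply: lNH.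
case: (pselect (exists x y, [/\ x \in NH, y \in NH, x != y, c x = c y & c x <> c h])).
  move=> [x [y [xs ys nxy cxy cxh]]].
  have [Ux Uy dxy] := collision adm FNH xs ys nxy cxy.
  have [_ _ ey] := disjoint_card2 dxy (s2NH x xs) (s2NH y ys).
  case: (boolP (i0 \in supp x)) => [|x0].
    rewrite memsupp => x0.
    by apply: (second_collision Ux Uy _ _ dxy x0 cxy cxh); apply: lNH.
  have y0 : y 0 i0 != 0 by rewrite -memsupp ey inE.
  apply: (second_collision Uy Ux _ _ _ y0 (esym cxy)); [exact: lNH|exact: lNH| |].
    by rewrite -finset.setCS finset.setCK.
  by rewrite -cxy.
move=> none.
(* A class without light vectors would leave 14 classes for 16 vectors, with
   only one class, that of h, having room for two. *)
have hit t : t != c 0 -> exists2 z, z \in NH & c z = t.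
  move=> t0; apply: contrapT => nohit.
  have := antipode_free_count adm (Z := [set c 0; t]%SET) (B := fun x => c x == c h) FNH s2NH.
  have -> : #|~: [set c 0; t]%SET| = 14%N.
    by have := cardsC [set c 0; t]%SET; rewrite cards2 -cardsT card_classes eq_sym t0 => -[].
  have := class_count adm (c h) FNH s2NH; move: NH16 => + + H.
  suff : (2 * size NH <= 2 * 14 + count (fun x => c x == c h) NH)%N by lia.
  apply: H => [x xs|x y xs ys nxy cxy].
    rewrite !inE negb_or; apply/andP; split; apply/eqP; first exact: (min_vector_cls adm (uNH x xs)).
    by move=> cxt; apply: nohit; exists x.
  by apply: contrapT => cxh; apply: none; exists x, y; split=> // /eqP.
have Ue0 : min_vector L (row4 1 0 0 0).
  by split=> //; rewrite l1norm_row4 normr1 !normr0 !addr0.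
have Ue1 : min_vector L (row4 0 1 0 0).
  by split; [exact: lat_axis1 | rewrite l1norm_row4 normr1 !normr0 !addr0 add0r].
have [z zs cz0] : exists2 z, z \in NH & c z = c (row4 1 0 0 0).
  by apply: hit; apply/eqP; apply: (min_vector_cls adm).
have Uz := uNH z zs; have hz := heavyPn (lNH z zs).
have cz1 : c z = c (row4 0 1 0 0).
  rewrite cz0; apply: (half_cls adm) => //; first exact: lat_axis1.
  by lat lat_rootm.
have n1 : `|1 : R| = 1 by rewrite normr1.
have z0 : z 0 i0 = 0.
  case: (cls_disjoint adm Uz Ue0 cz0 _ _ i0) => // [ze|ze|].
  - by have := hz i0; rewrite ze !row4E n1; lra.
  - by have := hz i0; rewrite ze mxE !row4E normrN n1; lra.
  - by rewrite row4E => /eqP; rewrite oner_eq0.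
have z1 : z 0 i1 = 0.
  case: (cls_disjoint adm Uz Ue1 cz1 _ _ i1) => // [ze|ze|].
  - by have := hz i1; rewrite ze !row4E n1; lra.
  - by have := hz i1; rewrite ze mxE !row4E normrN n1; lra.
  - by rewrite row4E => /eqP; rewrite oner_eq0.
have [z2 z3] : `|z 0 i2| = 2^-1 /\ `|z 0 i3| = 2^-1.
  have [_] := Uz; rewrite l1norm4 z0 z1 normr0.
  by move: (hz i2) (hz i3) => a b e; split; lra.
have [Lk' ck'] : L (row4 0 0 2^-1 (- 2^-1)) /\
    c (row4 0 0 2^-1 (- 2^-1)) = c (row4 1 0 0 0).
  have [Lz _] := Uz; move: Lz cz0; rewrite (row4_eta z) z0 z1.
  have notk : c (row4 0 0 2^-1 2^-1) <> c (row4 1 0 0 0).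
    rewrite -chk => /(cls_half adm Lh L0)/(lat_small adm); rewrite !row4_lin l1norm_row4.
    have -> : 2^-1 * (2^-1 - 1) = - 4^-1 :> R by lra.
    have -> : 2^-1 * (2^-1 - 0) = 4^-1 :> R by lra.
    have -> : 2^-1 * (0 - 0) = 0 :> R by lra.
    rewrite normrN normr0 gtr0_norm ?invr_gt0 //.
    rewrite row4_0 => /(_ _)/row4_inj[|_]; lra.
  case: (normr_pm z2) => ->; case: (normr_pm z3) => -> Lz cz //.
  - by have := clsN adm Lz; rewrite row4N oppr0 opprK cz => <-; split=> //; lat (latN adm Lz).
  - by case: notk; have := clsN adm Lz; rewrite row4N oppr0 opprK cz.
(* With u = (h + k)/2 and v = (h - k)/2 these are u - e_0, u - e_1, v + e_2
   and v + e_3. *)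
pose w0 : V := row4 (- (3 / 4)) 4^-1 4^-1 4^-1.
pose w1 : V := row4 4^-1 (- (3 / 4)) 4^-1 4^-1.
pose w2 : V := row4 4^-1 4^-1 (3 / 4) (- 4^-1).
pose w3 : V := row4 4^-1 4^-1 (- 4^-1) (3 / 4).
have L2 : L (row4 0 0 1 0) by lat (latD adm Lk Lk').
have L3 : L (row4 0 0 0 1) by lat (latB adm Lk Lk').
have Lw0 : L w0 by lat (latB adm lat_quarter_pppp L0).
have Lw1 : L w1 by lat (latB adm lat_quarter_pppp lat_axis1).
have Lw2 : L w2 by lat (latD adm lat_quarter_ppmm L2).
have Lw3 : L w3 by lat (latD adm lat_quarter_ppmm L3).
have Hk' := cls_half adm Lk' L0 ck'; have Hk2 := cls_halfD adm Lk' L0 ck'.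
have cw1 : c w0 = c w1 by apply: (half_cls adm) => //; lat (latN adm lat_rootm).
have cw2 : c w0 = c w2 by apply: (half_cls adm) => //; lat (latN adm Hk2).
have cw3 : c w0 = c w3 by apply: (half_cls adm) => //; lat Hk'.
have n4 : `|4^-1 : R| = 4^-1 by rewrite gtr0_norm ?invr_gt0.
have n34 : `|3 / 4 : R| = 3 / 4 by rewrite gtr0_norm // divr_gt0.
have [y ys cy] : exists2 y, y \in NH & c y = c w0.
  apply: hit; apply/eqP => /(cls_half adm Lw0 (lat0 adm)).
  rewrite subr0 => /(lat_small adm); rewrite l1normZ l1norm_row4 normrN n34 n4.
  rewrite gtr0_norm ?invr_gt0 // row4_0 row4Z => /(_ _)/row4_inj[|]; lra.
have y0 i w : L w -> c y = c w -> `|w 0 i| = 3 / 4 ->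
    (forall j, j != i -> `|w 0 j| = 4^-1) -> y 0 i = 0.
  by move=> Lw cw wi wj; apply: (light_far_from_spike (uNH y ys) (lNH y ys) Lw cw).
have [_] := uNH y ys; rewrite l1norm4.
have -> : y 0 i0 = 0.
  apply: (y0 _ w0) => //; first by rewrite row4E normrN.
  by apply: forall_ord4; rewrite ?eqxx ?row4E ?normrN.
have -> : y 0 i1 = 0.
  apply: (y0 _ w1); rewrite -?cw1 //; first by rewrite row4E normrN.
  by apply: forall_ord4; rewrite ?eqxx ?row4E ?normrN.
have -> : y 0 i2 = 0.
  apply: (y0 _ w2); rewrite -?cw2 //; first by rewrite row4E.
  by apply: forall_ord4; rewrite ?eqxx ?row4E ?normrN.
have -> : y 0 i3 = 0.
  apply: (y0 _ w3); rewrite -?cw3 //; first by rewrite row4E.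
  by apply: forall_ord4; rewrite ?eqxx ?row4E ?normrN.
by rewrite normr0 !addr0 => /eqP; rewrite eq_sym oner_eq0.
Qed.
End AxisNormalForm.

Lemma card2_other (T : finType) (A : {set T}) i : #|A| = 2%N -> i \in A ->
  exists2 j, j != i & A = [set i; j]%SET.
Proof.
move=> cA iA; have := cardsD1 i A; rewrite iA cA => -[/esym/eqP/cards1P[j Aj]].
have : j \in (A :\ i)%SET by rewrite Aj set11.
rewrite in_setD1 => /andP[ji _]; exists j => //.
by rewrite -Aj finset.setD1K.
Qed.

Lemma complementary_pairs (A B : {set 'I_4}) i : (A \subset ~: B)%SET ->
  (2 <= #|A|)%N -> (2 <= #|B|)%N -> i \in A -> exists j k l,
    [/\ uniq [:: i; j; k; l], A = [set i; j]%SET & B = [set k; l]%SET].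
Proof.
move=> dAB A2 B2 iA; have [cA cB eB] := disjoint_card2 dAB A2 B2.
have [k kB] : exists k, k \in B by apply/card_gt0P; rewrite cB.
have [j ji eA] := card2_other cA iA.
have [l lk eB2] := card2_other cB kB.
exists j, k, l; split=> //.
have kA : k \notin A by move: kB; rewrite eB inE.
have lA : l \notin A by have : l \in B; [rewrite eB2 !inE eqxx orbT|rewrite eB inE].
move: kA lA; rewrite eA /= !inE !negb_or => /andP[ki kj] /andP[li lj].
by rewrite [i == j]eq_sym [i == k]eq_sym [i == l]eq_sym [j == k]eq_sym [j == l]eq_sym
    [k == l]eq_sym ji ki li kj lj lk.
Qed.

Section AxisCase.
Variable R : realType.
Local Notation V := 'rV[R]_4.
Implicit Types (x y z w : V) (s : seq V).
Variables (L : set V) (c : V -> 'rV['F_2]_4).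
Hypothesis adm : admissible L c.

Lemma light_collision s : antipode_free L s -> (16 <= size [seq x <- s | ~~ heavy x])%N ->
  exists x y, [/\ x \in s, y \in s, x != y, c x = c y & ~~ heavy x && ~~ heavy y].
Proof.
move=> Fs; pose NH := [seq x <- s | ~~ heavy x]; rewrite -/NH => NH16.
have FNH : antipode_free L NH by apply: antipode_free_filter.
have [_ uNH _] := FNH.
apply: contrapT => none.
have := antipode_free_count adm (Z := [set c 0]%SET) (B := pred0) FNH.
have -> : #|~: [set c 0]%SET| = 15%N.
  by have := cardsC [set c 0]%SET; rewrite cards1 -cardsT card_classes => -[].
rewrite count_pred0 addn0 => H; suff : (2 * size NH <= 2 * 15)%N by lia.
apply: H => [x xs|x xs|x y].
- have [_ Nx] := uNH x xs; apply: supp_light => //.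
  by move: xs; rewrite mem_filter => /andP[].
- by rewrite inE; apply/eqP; apply: (min_vector_cls adm (uNH x xs)).
- rewrite !mem_filter => /andP[hx xs] /andP[hy ys] nxy cxy.
  by case: none; exists x, y; split=> //; rewrite hx.
Qed.

Lemma lat_sgn a x : `|a| = 1 -> L (a *: x) -> L x.
Proof.
case: (ger0P a) => _; first by move=> ->; rewrite scale1r.
by move=> a1; rewrite -[a]opprK a1 scaleN1r; move/(latN_eq adm).
Qed.

(** Two light vectors x and y share a class; the signed permutation that brings
    them to the normal form has the signs of the entries of x + y. *)
Lemma contains_halfD4_of_axis s i : L (delta_mx 0 i) -> antipode_free L s ->
  (20 <= size s)%N -> contains_halfD4 L.
Proof.
move=> Li Fs s20; have [us uS sN] := Fs.
have NH16 : (16 <= size [seq x <- s | ~~ heavy x])%N.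
  by have := light_count adm Fs; lia.
have [x [y [xs ys nxy cxy /andP[hx hy]]]] := light_collision Fs NH16.
wlog xi : x y xs ys nxy hx hy cxy / i \in supp x.
  move=> W; case: (boolP (i \in supp x)) => xi; first exact: (W x y).
  apply: (W y x); rewrite 1?eq_sym //.
  have [[_ Nx] [_ Ny] dxy] := collision adm Fs xs ys nxy cxy.
  have [_ _ ->] := disjoint_card2 dxy (supp_light Nx hx) (supp_light Ny hy).
  by rewrite inE.
have [[Lx Nx] [Ly Ny] dxy] := collision adm Fs xs ys nxy cxy.
have [cx cy ey] := disjoint_card2 dxy (supp_light Nx hx) (supp_light Ny hy).
have [j [k [l [uq ex ey2]]]] :=
  complementary_pairs dxy (supp_light Nx hx) (supp_light Ny hy) xi.
have hfx := supp_half Nx hx cx; have hfy := supp_half Ny hy cy.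
move: (uq); rewrite /= !inE !negb_or => /and4P[/and3P[ij ik il] /andP[jk jl] kl _].
have f_inj : injective (fun t : 'I_4 => nth i [:: i; j; k; l] t).
  by move=> a b /eqP; rewrite nth_uniq // => /eqP; apply: val_inj.
(* Every entry of x + y is 1/2 or -1/2. *)
pose q := perm f_inj; pose e t := 2 * (x + y) 0 t.
have xyE t : `|(x + y) 0 t| = 2^-1.
  rewrite mxE; case: (boolP (t \in supp x)) => tx.
    by rewrite (@supp_out _ y) ?addr0 ?hfx // ey inE tx.
  by rewrite (supp_out tx) add0r hfy // ey inE.
have e1 t : e t * e t = 1.
  by rewrite /e; case: (normr_pm (xyE t)) => ->; field.
have qE : [/\ q i0 = i, q i1 = j, q i2 = k & q i3 = l] by rewrite !permE.
pose p := (q^-1)%g.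
have pT (z w : V) : (forall t, e (q t) * z 0 t = w 0 (q t)) -> sperm p e z = w.
  move=> H; apply/rowP => m; rewrite mxE -[m in e m](permKV q) -[m in RHS](permKV q).
  by rewrite -/p H.
have [q0 q1 q2 q3] := qE.
have [xk xl] : x 0 k = 0 /\ x 0 l = 0.
  by split; apply: supp_out; rewrite ex !inE negb_or ![_ == i]eq_sym ![_ == j]eq_sym; apply/andP.
have [yi yj] : y 0 i = 0 /\ y 0 j = 0.
  by split; apply: supp_out; rewrite ey ex !inE eqxx ?orbT.
have Th : sperm p e (row4 2^-1 2^-1 0 0) = x.
  apply: pT; apply: forall_ord4; rewrite ?q0 ?q1 ?q2 ?q3 row4E /e mxE;
    by rewrite ?xk ?xl ?yi ?yj; field.
have Tk : sperm p e (row4 0 0 2^-1 2^-1) = y.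
  apply: pT; apply: forall_ord4; rewrite ?q0 ?q1 ?q2 ?q3 row4E /e mxE;
    by rewrite ?xk ?xl ?yi ?yj; field.
have Te : sperm p e (row4 1 0 0 0) = e i *: delta_mx 0 i.
  apply: pT; apply: forall_ord4; rewrite row4E ?q0 ?q1 ?q2 ?q3 !mxE /=.
  - by rewrite eqxx.
  - by rewrite [j == i]eq_sym (negPf ij) !mulr0.
  - by rewrite [k == i]eq_sym (negPf ik) !mulr0.
  - by rewrite [l == i]eq_sym (negPf il) !mulr0.
apply: (contains_halfD4_sperm (p := p) e1).
apply: (contains_halfD4_normal_form (admissible_sperm adm p e1) _ _ _ _ (antipode_free_sperm p e1 Fs)) => /=.
- rewrite Te; have [->|->] : e i = 1 \/ e i = -1.
  + by have /eqP := e1 i; rewrite -expr2 sqrf_eq1 => /orP[]/eqP; [left|right].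
  + by rewrite scale1r.
  + by rewrite scaleN1r; apply: (latN adm).
- by rewrite Th.
- by rewrite Tk.
- by rewrite Th Tk.
- by rewrite size_map.
Qed.

End AxisCase.

(** * No unit vector in the lattice *)

Lemma perm_ord4 (i j k l : 'I_4) : uniq [:: i; j; k; l] ->
  perm_eq (index_enum 'I_4) [:: i; j; k; l].
Proof.
move=> u; apply: uniq_perm => //; first exact: index_enum_uniq.
have /= [] := uniq_min_size u (s2 := index_enum 'I_4) => [t||_ H t].
- by rewrite mem_index_enum.
- by rewrite -[index_enum _]enumT size_enum_ord.
- by rewrite H.
Qed.

Lemma sum_uniq4 (V : nmodType) (F : 'I_4 -> V) i j k l : uniq [:: i; j; k; l] ->
  \sum_t F t = F i + F j + F k + F l.
Proof.
by move=> u; rewrite (perm_big _ (perm_ord4 u)) /= !big_cons big_nil addr0 !addrA.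
Qed.

Lemma uniq4_cover (i j k l t : 'I_4) : uniq [:: i; j; k; l] ->
  t = i \/ t = j \/ t = k \/ t = l.
Proof.
move=> /perm_ord4/perm_mem/(_ t); rewrite mem_index_enum !inE.
by move=> /esym/or4P[] /eqP; tauto.
Qed.

Section NoAxis.
Variable R : realType.
Local Notation V := 'rV[R]_4.
Implicit Types (x y z w : V) (s : seq V).
Variables (L : set V) (c : V -> 'rV['F_2]_4).
Hypothesis adm : admissible L c.
Hypothesis noaxis : forall i, ~ L (delta_mx 0 i).

Definition halfhalf x := ~~ heavy x && (#|supp x| == 2%N).

Lemma noaxis_supp x : min_vector L x -> (2 <= #|supp x|)%N.
Proof.
move=> [Lx Nx]; rewrite ltnNge; apply/negP => le1.
have : (0 < #|supp x|)%N.
  rewrite card_gt0; apply/eqP => s0; move: Nx; rewrite l1norm_supp s0 big_set0.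
  by move/eqP; rewrite eq_sym oner_eq0.
move=> gt0; have /cards1P[i si] : #|supp x| == 1%N by rewrite eqn_leq le1.
apply: (@noaxis i); apply: (lat_sgn adm (a := x 0 i)).
  by move: Nx; rewrite l1norm_supp si big_set1.
rewrite (_ : _ *: _ = x) //; apply/rowP => j; rewrite !mxE /=.
have [->|ji] := eqVneq j i; first by rewrite mulr1.
by rewrite mulr0 supp_out // si inE.
Qed.

(** If x and y have the same support and are not equal up to sign, they agree
    at one coordinate i and are opposite at the other one, so x + y is e_i up
    to sign. *)
Lemma halfhalf_inj s : antipode_free L s ->
  {in [seq x <- s | halfhalf x] &, injective (@supp R)}.
Proof.
move=> Fs x y; have [us uS sN] := Fs.
rewrite !mem_filter => /andP[/andP[hx /eqP cx] xs] /andP[/andP[hy /eqP cy] ys] exy.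
apply: contrapT => nxy; have nxNy := sN x y xs ys.
have [[Lx Nx] [Ly Ny]] := (uS x xs, uS y ys).
have [i xyi] : exists i, x 0 i != - y 0 i.
  apply: contrapT => H; apply: nxNy; apply/rowP => i; rewrite mxE.
  by apply: contrapT => /eqP Hi; apply: H; exists i.
have [j xyj] : exists j, x 0 j != y 0 j.
  apply: contrapT => H; apply: nxy; apply/rowP => j.
  by apply: contrapT => /eqP Hj; apply: H; exists j.
have ix : i \in supp x.
  apply: contra_neqT xyi => ix; rewrite (supp_out ix); rewrite exy in ix.
  by rewrite (supp_out ix) oppr0.
have jx : j \in supp x.
  apply: contra_neqT xyj => jx; rewrite (supp_out jx); rewrite exy in jx.
  by rewrite (supp_out jx).
have [xi xj] := (supp_half Nx hx cx ix, supp_half Nx hx cx jx).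
have iy : i \in supp y by rewrite -exy.
have jy : j \in supp y by rewrite -exy.
have [yi yj] := (supp_half Ny hy cy iy, supp_half Ny hy cy jy).
have ei : x 0 i = y 0 i.
  apply: contraNeq xyi; move: (normr_pm xi) (normr_pm yi).
  by move=> [] -> [] ->; rewrite ?eqxx ?opprK.
have ej : x 0 j = - y 0 j.
  apply: contraNeq xyj; move: (normr_pm xj) (normr_pm yj).
  by move=> [] -> [] ->; rewrite ?eqxx ?opprK ?eqxx.
have ji : j != i.
  apply: contraNneq xyj => ji; rewrite ji ei //.
have [j' j'i sx] := card2_other cx ix.
have ejj : j' = j by move: jx; rewrite sx !inE (negPf ji) /= => /eqP.
apply: (@noaxis i); apply: (lat_sgn adm (a := 2 * x 0 i)).
  by rewrite normrM xi gtr0_norm // mulfV // pnatr_eq0.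
rewrite (_ : _ *: _ = x + y); first exact: (latD adm).
apply/rowP => m; rewrite !mxE /=.
have [->|mi] := eqVneq m i; first by rewrite -ei /= mulr1 mulr2n mulrDl mul1r.
have [->|mj] := eqVneq m j; first by rewrite ej /= mulr0 addNr.
have mx : m \notin supp x by rewrite sx ejj !inE negb_or mi mj.
have my : m \notin supp y by rewrite -exy.
by rewrite (supp_out mx) (supp_out my) /= mulr0 addr0.
Qed.

(** There are 6 pairs of coordinates. *)
Lemma halfhalf_supports s : antipode_free L s ->
  let H := map (@supp R) [seq x <- s | halfhalf x] in
  (count halfhalf s <= 6)%N /\
  ((6 <= count halfhalf s)%N -> forall A : {set 'I_4}, #|A| = 2%N -> A \in H).
Proof.
move=> Fs H.
have uH : uniq H.
  rewrite map_inj_in_uniq; last exact: halfhalf_inj.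
  by case: Fs => us _ _; rewrite filter_uniq.
pose P := enum [set A : {set 'I_4} | #|A| == 2%N]%SET.
have sP : size P = 6%N by rewrite -cardE card_draws card_ord.
have HP : {subset H <= P}.
  move=> A /mapP[x]; rewrite mem_filter => /andP[/andP[_ cx] _] ->.
  by rewrite mem_enum inE.
have sH : size H = count halfhalf s by rewrite size_map size_filter.
split; first by rewrite -sH -sP; apply: uniq_leq_size.
rewrite -sH -sP => le6 A cA; have [_ ->] := uniq_min_size uH HP le6.
by rewrite mem_enum inE cA.
Qed.

(** Without unit vectors in L all supports have at least two elements. *)
Lemma noaxis_bound s (B : pred V) : antipode_free L s ->
  {in s &, forall x y, x != y -> c x = c y -> B x} ->
  (2 * size s <= 30 + count B s)%N.
Proof.
move=> Fs sB; have [us uS sN] := Fs.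
have := antipode_free_count adm (Z := [set c 0]%SET) (B := B) Fs.
have -> : #|~: [set c 0]%SET| = 15%N.
  by have := cardsC [set c 0]%SET; rewrite cards1 -cardsT card_classes => -[].
apply => // [x xs|x xs]; first exact: noaxis_supp (uS x xs).
by rewrite inE; apply/eqP; apply: (min_vector_cls adm (uS x xs)).
Qed.

(** Vectors sharing a class have exactly two nonzero coordinates, so they are
    heavy or half-half, and at most 4 are heavy. *)
Lemma noaxis_halfhalf s : antipode_free L s -> (20 <= size s)%N ->
  (6 <= count halfhalf s)%N.
Proof.
move=> Fs s20; have [us uS sN] := Fs.
have := noaxis_bound (B := fun x => heavy x || halfhalf x) Fs.
have := count_heavy adm Fs.
have := count_predUI (@heavy R) halfhalf s.
rewrite (_ : count (predU _ _) s = count (fun x => heavy x || halfhalf x) s) //.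
move=> e1 e2 e3; suff : (2 * size s <= 30 + count (fun x => heavy x || halfhalf x) s)%N by lia.
apply: e3 => x y xs ys nxy cxy; have [Ux Uy dxy] := collision adm Fs xs ys nxy cxy.
have [cx _ _] := disjoint_card2 dxy (noaxis_supp Ux) (noaxis_supp Uy).
by rewrite /halfhalf cx eqxx andbT orbN.
Qed.

End NoAxis.

(** From here on all (e_i - e_j)/2 lie in L, that is, a copy of the root lattice
    A_3 in the hyperplane of coordinate sum 0. *)

Section NoAxisA3.
Variable R : realType.
Local Notation V := 'rV[R]_4.
Implicit Types (x y z w g : V) (s : seq V).
Variables (L : set V) (c : V -> 'rV['F_2]_4).
Hypothesis adm : admissible L c.
Hypothesis noaxis : forall i, ~ L (delta_mx 0 i).
Hypotheses (L01 : L (row4 2^-1 (- 2^-1) 0 0)) (L02 : L (row4 2^-1 0 (- 2^-1) 0))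
  (L03 : L (row4 2^-1 0 0 (- 2^-1))).

Lemma halfA3 w : (forall i, 2 * w 0 i \is a Num.int) -> \sum_i w 0 i = 0 -> L w.
Proof.
move=> wi; rewrite sum_ord4 => eM.
have /intrP[m1 e1] := wi i1; have /intrP[m2 e2] := wi i2.
have /intrP[m3 e3] := wi i3.
have H := latD adm (latZz adm (- m1) L01) (latD adm (latZz adm (- m2) L02)
    (latZz adm (- m3) L03)).
move: H; rewrite [x in L x -> _](_ : _ = w) //.
rewrite [RHS]row4_eta !row4_lin !intrN -e1 -e2 -e3.
by congr (row4 _ _ _ _); lra.
Qed.

(** Modulo the copy of A_3, a half vector of nonzero coordinate sum is e_i up
    to sign. *)
Lemma halfhalf_sum0 x i j : i != j -> supp x = [set i; j]%SET -> L x ->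
  `|x 0 i| = 2^-1 -> `|x 0 j| = 2^-1 -> x 0 i + x 0 j = 0.
Proof.
move=> ij sx Lx xi xj; apply: contrapT => xij.
have S : \sum_t x 0 t = x 0 i + x 0 j.
  rewrite (bigD1 i) //= (bigD1 j) ?(eq_sym j) //= big1 ?addr0 ?addrA //.
  by move=> t /andP[ti tj]; rewrite supp_out // sx !inE negb_or ti tj.
have x_int t : 2 * x 0 t \is a Num.int.
  have half (a : R) : `|a| = 2^-1 -> 2 * a \is a Num.int.
    by case/normr_pm=> ->; rewrite ?mulrN mulfV ?pnatr_eq0 // ?rpredN rpred1.
  case: (boolP (t \in supp x)) => tx; last by rewrite (supp_out tx) mulr0.
  by move: tx; rewrite sx !inE => /orP[] /eqP ->; apply: half.
have eS : x 0 i + x 0 j = 1 \/ x 0 i + x 0 j = -1.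
  by case: (normr_pm xi) xij => ->; case: (normr_pm xj) => -> xij;
    first [left; lra | right; lra | case: xij; lra].
set a := x 0 i + x 0 j in S eS.
apply: (@noaxis i); apply: (lat_sgn adm (a := a)).
  by case: eS => ->; rewrite ?normrN normr1.
rewrite (_ : _ *: _ = x - (x - a *: delta_mx 0 i)); last by rewrite subKr.
apply: (latB adm) => //; apply: halfA3 => [t|].
  rewrite !mxE mulrBr rpredB // !rpredM ?rpred_nat //.
  by case: eS => ->; rewrite ?rpredN rpred1.
under eq_bigr do rewrite !mxE.
rewrite sumrB S (bigD1 i) //= eqxx mulr1 big1 ?addr0 ?subrr // => t /negPf ->.
by rewrite mulr0.
Qed.

Hypothesis Lquarter : forall g, (forall i, `|g 0 i| = 4^-1) -> \sum_i g 0 i = 0 -> L g.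

Definition on2 x i j := forall t, t != i -> t != j -> x 0 t = 0.

Lemma on2_l1norm x i j : i != j -> on2 x i j -> l1norm x = `|x 0 i| + `|x 0 j|.
Proof.
move=> ij sx; rewrite /l1norm (bigD1 i) //= (bigD1 j) 1?(eq_sym j) //=.
by rewrite big1 ?addr0 // => t /andP[ti tj]; rewrite sx // normr0.
Qed.

Lemma halfA3_root i j : i != j -> L (2^-1 *: (delta_mx 0 i - delta_mx 0 j)).
Proof.
move=> ij; apply: halfA3 => [t|].
  by rewrite !mxE mulrA mulfV ?pnatr_eq0 // mul1r rpredB // rpred_nat.
under eq_bigr do rewrite !mxE.
rewrite -mulr_sumr sumrB (bigD1 i) //= eqxx big1 => [|t /negPf->//].
rewrite [X in _ + _ - X](bigD1 j) //= eqxx big1 => [|t /negPf->//].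
by rewrite subrr mulr0.
Qed.

(** Otherwise x - (e_i - e_j)/2 is a nonzero vector of norm 2 |x_i - 1/2| < 1. *)
Lemma opposite_signs x i j : i != j -> on2 x i j -> L x -> l1norm x = 1 ->
  0 < x 0 i -> x 0 j < 0 -> x 0 i = 2^-1.
Proof.
move=> ij sx Lx; rewrite (on2_l1norm ij sx) => Nx xi xj.
move: Nx; rewrite gtr0_norm // ltr0_norm // => Nx.
pose d : V := x - 2^-1 *: (delta_mx 0 i - delta_mx 0 j).
have di : d 0 i = x 0 i - 2^-1 by rewrite !mxE !eqxx (negPf ij) /=; ring.
have dj : d 0 j = x 0 i - 2^-1.
  have exj : x 0 j = x 0 i - 1 by lra.
  by rewrite !mxE !eqxx [j == i]eq_sym (negPf ij) /= exj; field.
have d2 : on2 d i j.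
  by move=> t ti tj; rewrite !mxE sx // (negPf ti) (negPf tj) /=; ring.
have : d = 0.
  apply: (lat_small adm); first exact: (latB adm Lx (halfA3_root ij)).
  rewrite (on2_l1norm ij d2) di dj.
  by case: (ger0P (x 0 i - 2^-1)) => ?; lra.
by move=> d0; move: di; rewrite d0 mxE; lra.
Qed.

Lemma heavy_same_sign x i j : i != j -> on2 x i j -> min_vector L x -> heavy x ->
  exists x', [/\ x' = x \/ x' = - x, 0 < x' 0 i, 0 < x' 0 j,
    x' 0 i + x' 0 j = 1 & x' 0 i != 2^-1].
Proof.
move=> ij sx [Lx Nx] hx.
have nh : `|x 0 i| != 2^-1.
  apply: contraTneq hx => xi; apply/existsPn => t; rewrite -leNgt.
  have := Nx; rewrite (on2_l1norm ij sx) xi => xj.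
  have [->|ti] := eqVneq t i; first by rewrite xi.
  have [->|tj] := eqVneq t j; first by lra.
  by rewrite sx // normr0 invr_ge0.
have := Nx; rewrite (on2_l1norm ij sx) => Nx2.
have sNx : on2 (- x) i j by move=> t ti tj; rewrite mxE sx // oppr0.
have [xj0|xj0] := eqVneq (x 0 j) 0.
  case: (noaxis (i := i)); apply: (lat_sgn adm (a := x 0 i)).
    by move: Nx2; rewrite xj0 normr0 addr0.
  rewrite (_ : _ *: _ = x) //; apply/rowP => t; rewrite !mxE /=.
  have [->|ti] := eqVneq t i; first by rewrite mulr1.
  rewrite mulr0; have [->|tj] := eqVneq t j; first by rewrite xj0.
  by rewrite sx.
have [xi0|xi0] := eqVneq (x 0 i) 0.
  case: (noaxis (i := j)); apply: (lat_sgn adm (a := x 0 j)).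
    by move: Nx2; rewrite xi0 normr0 add0r.
  rewrite (_ : _ *: _ = x) //; apply/rowP => t; rewrite !mxE /=.
  have [->|tj] := eqVneq t j; first by rewrite mulr1.
  rewrite mulr0; have [->|ti] := eqVneq t i; first by rewrite xi0.
  by rewrite sx.
have NNx : l1norm (- x) = 1 by rewrite l1normN.
have LNx := latN adm Lx.
move: xi0 xj0; rewrite !neq_lt => /orP[] xi /orP[] xj.
- exists (- x); rewrite !mxE; split; [by right | lra | lra | |].
    by move: Nx2; rewrite !ltr0_norm.
  by move: nh; rewrite ltr0_norm.
- have := opposite_signs ij sNx LNx NNx; rewrite !mxE !oppr_gt0 oppr_lt0.
  by move=> /(_ xi xj) e; move: nh; rewrite -normrN e gtr0_norm ?invr_gt0 // eqxx.
- have := opposite_signs ij sx Lx Nx xi xj => e.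
  by move: nh; rewrite e gtr0_norm ?invr_gt0 // eqxx.
- exists x; split => //; [by left | |].
    by move: Nx2; rewrite !gtr0_norm.
  by move: nh; rewrite gtr0_norm.
Qed.

(** The vector (x - y)/2 is at distance |x_i - 1/2| + |y_k - 1/2| < 1 from the
    vector of L with entries 1/4 at i, j and -1/4 at k, l. *)
Lemma same_sign_pair x y i j k l : uniq [:: i; j; k; l] -> on2 x i j -> on2 y k l ->
  L (2^-1 *: (x - y)) -> 0 < x 0 i -> 0 < x 0 j -> x 0 i + x 0 j = 1 ->
  0 < y 0 k -> 0 < y 0 l -> y 0 k + y 0 l = 1 -> x 0 i = 2^-1.
Proof.
move=> u sx sy Lxy xi xj xij yk yl ykl.
move: (u); rewrite /= !inE !negb_or => /and4P[/and3P[ij ik il] /andP[jk jl] kl _].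
pose g : V := 4^-1 *: (delta_mx 0 i + delta_mx 0 j - delta_mx 0 k - delta_mx 0 l).
have [gi gj gk gl] : [/\ g 0 i = 4^-1, g 0 j = 4^-1, g 0 k = - 4^-1 & g 0 l = - 4^-1].
  rewrite !mxE !eqxx ![k == _]eq_sym ![l == _]eq_sym ![j == i]eq_sym.
  by rewrite (negPf ij) (negPf ik) (negPf il) (negPf jk) (negPf jl) (negPf kl) /=; split; ring.
have Lg : L g.
  apply: Lquarter => [t|]; last by rewrite (sum_uniq4 _ u) gi gj gk gl; ring.
  have n4 : `|4^-1 : R| = 4^-1 by rewrite gtr0_norm ?invr_gt0.
  by case: (uniq4_cover t u) => [->|[->|[->|->]]]; rewrite ?gi ?gj ?gk ?gl ?normrN n4.
have := latB adm Lxy Lg; set z := _ - g => Lz.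
have [zi zj] : z 0 i = 2^-1 * (x 0 i - 2^-1) /\ z 0 j = - (2^-1 * (x 0 i - 2^-1)).
  split; rewrite mxE ![(- g) 0 _]mxE ?gi ?gj !mxE ?(sy i) ?(sy j) //; first by field.
  have -> : x 0 j = 1 - x 0 i by lra.
  by field.
have [zk zl] : z 0 k = - (2^-1 * (y 0 k - 2^-1)) /\ z 0 l = 2^-1 * (y 0 k - 2^-1).
  split; rewrite mxE ![(- g) 0 _]mxE ?gk ?gl !mxE ?(sx k) ?(sx l) // 1?eq_sym //; first by field.
  have -> : y 0 l = 1 - y 0 k by lra.
  by field.
have z0 : z = 0.
  apply: (lat_small adm Lz); rewrite /l1norm (sum_uniq4 _ u) zi zj zk zl !normrN.
  case: (ger0P (2^-1 * (x 0 i - 2^-1))) => ?; case: (ger0P (2^-1 * (y 0 k - 2^-1))) => ?; lra.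
by move: zi; rewrite z0 mxE; lra.
Qed.

End NoAxisA3.

Section NoAxisContradiction.
Variable R : realType.
Local Notation V := 'rV[R]_4.
Implicit Types (x y z w g : V) (s : seq V).

Lemma supp_on2 x i j : supp x = [set i; j]%SET -> on2 x i j.
Proof. by move=> sx t ti tj; rewrite supp_out // sx !inE negb_or ti tj. Qed.

Lemma quarter_diff_int (a b : R) : `|a| = 4^-1 -> `|b| = 4^-1 ->
  2 * (a - b) \is a Num.int.
Proof.
case/normr_pm=> -> /normr_pm[] ->.
- by rewrite subrr mulr0.
- by rewrite (_ : 2 * _ = 1) ?rpred1 //; field.
- by rewrite (_ : 2 * _ = -1) ?rpredN ?rpred1 //; field.
- by rewrite subrr mulr0.
Qed.

Section WithA3.
Variables (L : set V) (c : V -> 'rV['F_2]_4).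
Hypothesis adm : admissible L c.
Hypothesis noaxis : forall i, ~ L (delta_mx 0 i).
Hypotheses (L01 : L (row4 2^-1 (- 2^-1) 0 0)) (L02 : L (row4 2^-1 0 (- 2^-1) 0))
  (L03 : L (row4 2^-1 0 0 (- 2^-1))).

Let sum0 := halfhalf_sum0 adm noaxis L01 L02 L03.

Lemma halfhalf_halfsum x y i j k l : uniq [:: i; j; k; l] ->
  supp x = [set i; j]%SET -> supp y = [set k; l]%SET ->
  min_vector L x -> min_vector L y -> ~~ heavy x -> ~~ heavy y ->
  (forall t, `|(2^-1 *: (x - y)) 0 t| = 4^-1) /\ \sum_t (2^-1 *: (x - y)) 0 t = 0.
Proof.
move=> u sx sy [Lx Nx] [Ly Ny] hx hy.
move: (u); rewrite /= !inE !negb_or => /and4P[/and3P[ij ik il] /andP[jk jl] kl _].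
have cx : #|supp x| = 2%N by rewrite sx cards2 ij.
have cy : #|supp y| = 2%N by rewrite sy cards2 kl.
have hfx := supp_half Nx hx cx; have hfy := supp_half Ny hy cy.
have [xi xj yk yl] : [/\ `|x 0 i| = 2^-1, `|x 0 j| = 2^-1, `|y 0 k| = 2^-1 & `|y 0 l| = 2^-1].
  by split; [apply: hfx|apply: hfx|apply: hfy|apply: hfy]; rewrite ?sx ?sy !inE eqxx ?orbT.
have [o2x o2y] := (supp_on2 sx, supp_on2 sy).
have [xk xl] : x 0 k = 0 /\ x 0 l = 0 by split; apply: o2x; rewrite // eq_sym.
have [yi yj] : y 0 i = 0 /\ y 0 j = 0 by split; apply: o2y.
have Sx := sum0 ij sx Lx xi xj; have Sy := sum0 kl sy Ly yk yl.
split => [t|].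
  have q (a : R) : `|a| = 2^-1 -> `|2^-1 * a| = 4^-1.
    by move=> e; rewrite normrM e gtr0_norm ?invr_gt0 //; field.
  case: (uniq4_cover t u) => [->|[->|[->|->]]]; rewrite !mxE ?yi ?yj ?xk ?xl ?subr0 ?sub0r;
    by apply: q; rewrite ?normrN.
rewrite (sum_uniq4 _ u) !mxE yi yj xk xl !subr0 !sub0r.
have -> : x 0 j = - x 0 i by lra.
by have -> : y 0 l = - y 0 k by [lra]; ring.
Qed.

(** Two light vectors of the same class give a vector with two entries 1/4 and
    two entries -1/4, and the copy of A_3 gives all the others.  A heavy x and a
    light y supported on complementary pairs cannot share a class: the half
    vector (e_i - e_j)/2 with the support of x would be in the same class.  Two
    heavy vectors are excluded by [same_sign_pair].  So only the at most 6
    half-half vectors share classes. *)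
Lemma noaxis_A3_false s : antipode_free L s -> (20 <= size s)%N -> False.
Proof.
move=> Fs s20; have [us uS sN] := Fs.
have supp2 x : x \in s -> (2 <= #|supp x|)%N.
  by move=> xs; apply: (noaxis_supp adm noaxis (uS x xs)).
have Lquarter g : (forall i, `|g 0 i| = 4^-1) -> \sum_i g 0 i = 0 -> L g.
  have NH16 : (16 <= size [seq x <- s | ~~ heavy x])%N.
    by have := light_count adm Fs; lia.
  have [x [y [xs ys nxy cxy /andP[hx hy]]]] := light_collision adm Fs NH16.
  have [Ux Uy dxy] := collision adm Fs xs ys nxy cxy.
  have [i ix] : exists i, i \in supp x by apply/card_gt0P/ltnW/supp2.
  have [j [k [l [u ex ey]]]] := complementary_pairs dxy (supp2 x xs) (supp2 y ys) ix.
  have [q4 q0] := halfhalf_halfsum u ex ey Ux Uy hx hy.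
  have [[Lx _] [Ly _]] := (Ux, Uy).
  have := cls_half adm Lx Ly cxy; set q := _ *: _ in q4 q0 * => Lq g4 g0; clearbody q.
  rewrite -[g](subrK q); apply: (latD adm) => //.
  apply: (halfA3 adm L01 L02 L03) => [t|].
    by rewrite !mxE; apply: quarter_diff_int.
  under eq_bigr do rewrite !mxE.
  by rewrite sumrB g0 sub0r -[RHS]oppr0 -[in RHS]q0; congr (- _); apply: eq_bigr => t _; rewrite !mxE.
have [h6 _] := halfhalf_supports adm noaxis Fs.
suff : (2 * size s <= 30 + count (@halfhalf R) s)%N by lia.
apply: (noaxis_bound adm noaxis Fs) => x y xs ys nxy cxy.
have [Ux Uy dxy] := collision adm Fs xs ys nxy cxy.
have [cx cy ey] := disjoint_card2 dxy (supp2 x xs) (supp2 y ys).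
rewrite /halfhalf cx eqxx andbT; apply/negP => hx.
have [i ix] : exists i, i \in supp x by apply/card_gt0P/ltnW/supp2.
have [j [k [l [u sx sy]]]] := complementary_pairs dxy (supp2 x xs) (supp2 y ys) ix.
move: (u); rewrite /= !inE !negb_or => /and4P[/and3P[ij ik il] /andP[jk jl] kl _].
have [o2x o2y] := (supp_on2 sx, supp_on2 sy).
have [[Lx Nx] [Ly Ny]] := (Ux, Uy).
clear cx cy ey h6.
case: (boolP (heavy y)) => hy.
  have [x' [ex' xi xj xij nx]] := heavy_same_sign adm noaxis L01 L02 L03 ij o2x Ux hx.
  have [y' [ey' yk yl ykl _]] := heavy_same_sign adm noaxis L01 L02 L03 kl o2y Uy hy.
  have [Lx' cx'] : L x' /\ c x' = c x.
    by case: ex' => ->; split=> //; [exact: (latN adm) | exact: (clsN adm)].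
  have [Ly' cy'] : L y' /\ c y' = c y.
    by case: ey' => ->; split=> //; [exact: (latN adm) | exact: (clsN adm)].
  have o2x' : on2 x' i j.
    by move=> t ti tj; case: ex' => ->; rewrite ?mxE o2x // oppr0.
  have o2y' : on2 y' k l.
    by move=> t ti tj; case: ey' => ->; rewrite ?mxE o2y // oppr0.
  have Lxy : L (2^-1 *: (x' - y')) by apply: (cls_half adm); rewrite // cx' cy'.
  by move: nx; rewrite (same_sign_pair adm Lquarter u o2x' o2y' Lxy) ?eqxx.
pose x' : V := 2^-1 *: (delta_mx 0 i - delta_mx 0 j).
have Lx' : L x' by apply: (halfA3_root adm L01 L02 L03).
have [xi' xj'] : x' 0 i = 2^-1 /\ x' 0 j = - 2^-1.
  by rewrite !mxE !eqxx [j == i]eq_sym (negPf ij) /=; split; ring.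
have o2x' : on2 x' i j by move=> t ti tj; rewrite !mxE (negPf ti) (negPf tj) /=; ring.
have n2 : `|2^-1 : R| = 2^-1 by rewrite gtr0_norm ?invr_gt0.
have Ux' : min_vector L x'.
  by split=> //; rewrite (on2_l1norm ij o2x') xi' xj' normrN n2; field.
have hx' : ~~ heavy x'.
  apply/existsPn => t; rewrite -leNgt; have [->|ti] := eqVneq t i; first by rewrite xi' n2.
  have [->|tj] := eqVneq t j; first by rewrite xj' normrN n2.
  by rewrite o2x' // normr0 invr_ge0.
have sx' : supp x' = [set i; j]%SET.
  apply/setP => t; rewrite !inE; have [->|ti] := eqVneq t i.
    by rewrite xi' invr_eq0 pnatr_eq0.
  have [->|tj] := eqVneq t j; first by rewrite xj' oppr_eq0 invr_eq0 pnatr_eq0.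
  by rewrite o2x' // eqxx.
have [q4 q0] := halfhalf_halfsum u sx' sy Ux' Uy hx' hy.
have cxx' : c x = c x' by rewrite cxy; symmetry; apply: (half_cls adm) => //; apply: Lquarter.
case: (cls_disjoint adm Ux Ux' cxx' _ _ i).
- by move=> e; move: hx; rewrite e (negPf hx').
- move=> e; move: hx; rewrite e => /existsP[t]; rewrite mxE normrN ltNge.
  by rewrite (heavyPn hx').
- by move=> /eqP; apply/negP; rewrite -memsupp sx !inE eqxx.
- by rewrite xi' => /eqP; rewrite invr_eq0 pnatr_eq0.
Qed.

End WithA3.
End NoAxisContradiction.

(** * The lattice contains D_4/2 *)

Section Axis.
Variable R : realType.
Local Notation V := 'rV[R]_4.
Implicit Types (x y z w g : V) (s : seq V).

(** The six half-half vectors (+-1/2, +-1/2) all occur; changing the signs of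
    the coordinates 1, 2, 3 turns those involving coordinate 0 into
    (e_0 - e_j)/2, up to sign. *)
Lemma axis_exists (L : set V) (c : V -> 'rV['F_2]_4) s : admissible L c ->
  antipode_free L s -> (20 <= size s)%N -> exists i, L (delta_mx 0 i).
Proof.
move=> adm Fs s20; apply: contrapT => none.
have noaxis i : ~ L (delta_mx 0 i) by move=> Li; apply: none; exists i.
have [_ hh] := halfhalf_supports adm noaxis Fs.
have {}hh := hh (noaxis_halfhalf adm noaxis Fs s20).
have H j : j != i0 -> exists2 a : R, a * a = 1 &
    L (2^-1 *: (delta_mx 0 i0 - a *: delta_mx 0 j)).
  move=> j0; have c2 : #|[set i0; j]%SET| = 2%N by rewrite cards2 eq_sym j0.
  have /mapP[x] := hh _ c2; rewrite mem_filter => /andP[/andP[hx /eqP cx] xs] sx.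
  have [_ uS _] := Fs; have [Lx Nx] := uS x xs.
  have x0 : `|x 0 i0| = 2^-1 by apply: supp_half; rewrite // -sx !inE eqxx.
  have xj : `|x 0 j| = 2^-1 by apply: supp_half; rewrite // -sx !inE eqxx orbT.
  exists (- (4 * x 0 i0 * x 0 j)).
    by case: (normr_pm x0) => ->; case: (normr_pm xj) => ->; field.
  rewrite (_ : 2^-1 *: _ = (2 * x 0 i0) *: x).
    case: (normr_pm x0) => ->; rewrite ?mulrN mulfV ?pnatr_eq0 // ?scaleN1r ?scale1r //.
    exact: (latN adm).
  apply/rowP => t; rewrite !mxE /=; have [->|tj] := eqVneq t j.
    rewrite (negPf j0) /=.
    by case: (normr_pm x0) => ->; field.
  have [->|t0] := eqVneq t i0; first by case: (normr_pm x0) => -> /=; field.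
  have -> : x 0 t = 0 by apply: (supp_on2 (esym sx)).
  by rewrite /=; ring.
have [a1 a1E H1] := H i1 isT; have [a2 a2E H2] := H i2 isT; have [a3 a3E H3] := H i3 isT.
pose e i := row4 1 a1 a2 a3 0 i.
have e1 i : e i * e i = 1.
  by move: i; apply: forall_ord4; rewrite /e row4E // mulr1.
have T1 x : sperm 1%g e x = row4 (x 0 i0) (a1 * x 0 i1) (a2 * x 0 i2) (a3 * x 0 i3).
  by apply/rowP; apply: forall_ord4; rewrite row4E mxE perm1 /e row4E ?mul1r.
apply: (noaxis_A3_false (admissible_sperm adm 1%g e1) _ _ _ _ (antipode_free_sperm 1%g e1 Fs)).
- move=> i /= Li; apply: (noaxis i); apply: (lat_sgn adm (a := e i)); first exact: norm_sign.
  rewrite (_ : _ *: _ = sperm 1%g e (delta_mx 0 i)) //; apply/rowP => t.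
  by rewrite !mxE perm1 /=; have [->|ti] := eqVneq t i; rewrite ?mulr0.
- rewrite /= T1 !row4E; apply: (eq_ind _ _ H1).
  by apply/rowP; apply: forall_ord4; rewrite row4E !mxE /=; ring.
- rewrite /= T1 !row4E; apply: (eq_ind _ _ H2).
  by apply/rowP; apply: forall_ord4; rewrite row4E !mxE /=; ring.
- rewrite /= T1 !row4E; apply: (eq_ind _ _ H3).
  by apply/rowP; apply: forall_ord4; rewrite row4E !mxE /=; ring.
- by rewrite size_map.
Qed.

Lemma contains_halfD4_of_20 (L : set V) (c : V -> 'rV['F_2]_4) s : admissible L c ->
  antipode_free L s -> (20 <= size s)%N -> contains_halfD4 L.
Proof.
move=> adm Fs s20; have [i Li] := axis_exists adm Fs s20.
exact: (contains_halfD4_of_axis adm Li Fs s20).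
Qed.
End Axis.

(** * From cardinalities of sets to sequences *)

Section Cardinality.
Variable T : choiceType.
Implicit Types (A : set T) (s : seq T).

Lemma card_eq_uniq_seq A s : uniq s -> A = [set` s] -> A #= `I_(size s).
Proof.
case: s => [|x0 s] us ->; first by rewrite set_nil II0.
set t := x0 :: s in us *.
rewrite (_ : [set` t] = [set nth x0 t i | i in `I_(size t)]); last first.
  apply/seteqP; split => x /=.
    move=> xt; exists (index x t); last exact: nth_index.
    by move: xt; rewrite -index_mem.
  by move=> [i /= lti <-]; apply: mem_nth.
apply: inj_card_eq => i j /set_mem/= lti /set_mem/= ltj /eqP.
by rewrite nth_uniq // => /eqP.
Qed.

Lemma card_eq_uniq_seqP A n : A #= `I_n ->
  exists s, [/\ uniq s, A = [set` s] & size s = n].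
Proof.
move=> An; exists (finmap.enum_fset (fset_set A)).
split; [exact: finmap.fset_uniq | | exact: card_fset_set].
have fA : finite_set A by exists n.
by rewrite -[LHS]fset_setK.
Qed.

Lemma card_le_uniq_seq A n :
  (forall s, uniq s -> (forall x, x \in s -> A x) -> (size s <= n)%N) -> A #<= `I_n.
Proof.
move=> H; case: (pselect (finite_set A)) => [fA|iA].
  have eA : A = [set` finmap.enum_fset (fset_set A)] by rewrite -[LHS]fset_setK.
  have us := finmap.fset_uniq (fset_set A).
  rewrite (card_le_eql (card_eq_uniq_seq us eA)).
  rewrite card_le_II; apply: H => // x xs; rewrite eA; exact: xs.
have [B BA nB] := infinite_set_fset n.+1 iA.
have := H (finmap.enum_fset B) (finmap.fset_uniq B) (fun x xB => BA x xB).
by move=> /(leq_trans nB); rewrite ltnn.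
Qed.

End Cardinality.

Section LatticeClasses.
Variable R : realType.
Local Notation V := 'rV[R]_4.
Implicit Types (x y z w g : V) (s : seq V).

(** Of 39 minimal vectors, 20 have a positive first nonzero coordinate, or 20
    have a negative one. *)
Lemma antipode_free_half (L : set V) (c : V -> 'rV['F_2]_4) s : admissible L c ->
  uniq s -> (forall x, x \in s -> min_vector L x) -> (39 <= size s)%N ->
  exists2 s', antipode_free L s' & (20 <= size s')%N.
Proof.
move=> adm us sU s39.
pose pos x := [|| 0 < x 0 i0, (x 0 i0 == 0) && (0 < x 0 i1),
  [&& x 0 i0 == 0, x 0 i1 == 0 & 0 < x 0 i2] |
  [&& x 0 i0 == 0, x 0 i1 == 0, x 0 i2 == 0 & 0 < x 0 i3]].
have posN x : x != 0 -> pos (- x) = ~~ pos x.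
  move=> x0; rewrite /pos !mxE !oppr_gt0 !oppr_eq0.
  case: (ltgtP (x 0 i0) 0) => //= e0; case: (ltgtP (x 0 i1) 0) => //= e1.
  case: (ltgtP (x 0 i2) 0) => //= e2; case: (ltgtP (x 0 i3) 0) => //= e3.
  by move: x0; rewrite [x]row4_eta e0 e1 e2 e3 -row4_0 eqxx.
have U0 x : x \in s -> x != 0.
  move=> /sU[_ Nx]; apply: contra_eq_neq Nx => ->.
  by rewrite l1norm0 eq_sym oner_eq0.
have half (a : pred V) : (forall x, x \in s -> a (- x) = ~~ a x) ->
    antipode_free L [seq x <- s | a x].
  move=> aN; split; first exact: filter_uniq.
    by move=> x; rewrite mem_filter => /andP[_ /sU].
  move=> x y; rewrite !mem_filter => /andP[ax xs] /andP[ay ys] e.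
  by move: ax; rewrite e aN // ay.
have [h|h] := leqP 20 (count pos s).
  exists [seq x <- s | pos x]; last by rewrite size_filter.
  by apply: half => x /U0; apply: posN.
exists [seq x <- s | ~~ pos x].
  by apply: (half (fun x => ~~ pos x)) => x /U0/posN ->.
rewrite size_filter -(leq_add2l (count pos s)) [X in (_ <= X)%N]count_predC.
by apply: leq_trans s39; rewrite -[39%N]/(19 + 20)%N leq_add2r.
Qed.

Lemma intr_F2_eq (m n : int) : (m%:~R == n%:~R :> 'F_2) = (2 %| m - n)%Z.
Proof.
by rewrite (dvdz_pcharf (pchar_Fp (isT : prime 2))) intrB subr_eq0.
Qed.

Lemma lattice_admissible (L : set V) : is_lattice L -> is_l1_minimum L 1 ->
  exists c, admissible L c.
Proof.
move=> [B uB ->] [_ Lmin].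
exists (fun x => \row_j ((Num.floor ((x *m invmx B) 0 j))%:~R : 'F_2)).
have cE (z : 'rV[int]_4) :
    \row_j ((Num.floor ((map_mx intr z *m B *m invmx B) 0 j))%:~R : 'F_2) =
    map_mx intr z.
  by apply/rowP => j; rewrite mulmxK // !mxE intrKfloor.
split => //.
- by exists 0 => //; rewrite map_mx0 mul0mx.
- by move=> _ _ [z _ <-] [w _ <-]; exists (z - w) => //; rewrite map_mxB mulmxBl.
- move=> _ _ [z _ <-] [w _ <-]; rewrite !cE; split.
  + move=> /rowP e; exists (\row_j divz (z 0 j - w 0 j) 2) => //.
    rewrite -mulmxBl scalemxAl; congr (_ *m _); apply/rowP => j; rewrite !mxE.
    have := e j; rewrite !mxE => /eqP; rewrite intr_F2_eq => /dvdzP[q eq].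
    by rewrite -intrB eq mulzK // intrM mulrC mulfK // pnatr_eq0.
  + move=> [u _]; rewrite -mulmxBl scalemxAl => /(can_inj (mulmxK uB))/rowP e.
    apply/rowP => j; rewrite !mxE; apply/eqP; rewrite intr_F2_eq; apply/dvdzP.
    exists (u 0 j); have := e j; rewrite !mxE -intrB => e'.
    by apply: (@intr_inj R); rewrite intrM e'; field.
Qed.

End LatticeClasses.

(** * Lattices containing D_4/2 *)

Section D4plus.
Variable R : realType.
Local Notation V := 'rV[R]_4.
Implicit Types (x y z w : V) (s : seq V).

Lemma half_int (n : int) : (2 %| n)%Z -> 2^-1 * (n%:~R : R) \is a Num.int.
Proof.
by move=> /dvdzP[q ->]; rewrite intrM mulrC mulfK ?pnatr_eq0 // intr_int.
Qed.

Definition halfint (f : 'I_4 -> int) : V := \row_i (2^-1 * (f i)%:~R).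

Lemma halfD4_halfint f : (2 %| \sum_i f i)%Z -> halfD4 (halfint f).
Proof.
move=> df; split=> [i|]; first by rewrite mxE mulVKf ?pnatr_eq0 // intr_int.
under eq_bigr do rewrite mxE.
by rewrite -mulr_sumr -rmorph_sum; apply: half_int.
Qed.

(** Round 2 x to the nearest integer vector d, and let r_i <= 1/2 be the
    rounding errors.  If the sum of d is even, then x is at distance
    (r_0 + ... + r_3)/2 from D_4/2.  If it is odd, then for each i rounding at i
    to the other side gives a point of D_4/2 at distance
    (r_0 + ... + r_3 + 1 - 2 r_i)/2.  As x is not in D_4/2, all these distances
    are at least 1, which forces r_i = 1/2 for all i. *)
Lemma lat_halfD4_or_odd (L : set V) (c : V -> 'rV['F_2]_4) x : admissible L c ->
  contains_halfD4 L -> L x -> halfD4 x \/ forall i, 2 * x 0 i - 2^-1 \is a Num.int.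
Proof.
move=> adm HL Lx; case: (pselect (halfD4 x)) => [|nx]; [by left|right].
pose d i := Num.floor (2 * x 0 i + 2^-1).
pose r i := `|2 * x 0 i - (d i)%:~R|.
have dle i : (d i)%:~R <= 2 * x 0 i + 2^-1 < (d i)%:~R + 1 by rewrite -intrD1 floor_itv.
have r2 i : r i <= 2^-1.
  by rewrite ler_norml; have /andP[] := dle i; lra.
have far f : (2 %| \sum_i f i)%Z -> 2 <= \sum_i `|2 * x 0 i - (f i)%:~R|.
  move=> df; have Hf := halfD4_halfint df.
  have := latB adm Lx (HL _ Hf); rewrite leNgt => Ld; apply/negP => lt2.
  apply: nx; suff -> : x = halfint f by [].
  apply/eqP; rewrite -subr_eq0; apply/eqP; apply: (lat_small adm Ld).
  rewrite (_ : l1norm _ = 2^-1 * \sum_i `|2 * x 0 i - (f i)%:~R|).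
    by rewrite ltr_pdivrMl // mulr1.
  rewrite /l1norm mulr_sumr; apply: eq_bigr => i _; rewrite !mxE.
  rewrite -[X in X * `|_|]gtr0_norm ?invr_gt0 // -normrM; congr `|_|; by field.
have sr : 2 <= \sum_i r i.
  case: (boolP (2 %| \sum_i d i)%Z) => [/far //|odd_d].
  pose e i := if (d i)%:~R <= 2 * x 0 i then d i + 1 else d i - 1.
  have re i : `|2 * x 0 i - (e i)%:~R| = 1 - r i.
    rewrite /r /e; have /andP[] := dle i.
    case: (leP (d i)%:~R (2 * x 0 i)) => h h1 h2.
      rewrite intrD [X in _ = 1 - X]ger0_norm ?subr_ge0 // ler0_norm; lra.
    rewrite intrB [X in _ = 1 - X]ltr0_norm ?subr_lt0 // ger0_norm; lra.
  have fe i : 2 <= \sum_j r j + 1 - 2 * r i.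
    have S : \sum_j r j = r i + \sum_(j < 4 | j != i) r j by rewrite (bigD1 i).
    have := far (fun j => if j == i then e i else d j).
    rewrite (bigD1 i) //= eqxx (eq_bigr d) => [|j /negPf-> //].
    rewrite [X in 2 <= X](bigD1 i) //= eqxx re.
    rewrite [X in 2 <= _ + X](eq_bigr r) => [|j /negPf-> //].
    move=> H; suff : 2 <= 1 - r i + \sum_(j < 4 | j != i) r j by rewrite S; lra.
    apply: H; move: odd_d; rewrite (bigD1 i) //=; rewrite /e; case: ifP => _; lia.
  by move: (fe i0) (fe i1) (fe i2) (fe i3); rewrite sum_ord4; lra.
have rE : forall i, r i = 2^-1.
  move: sr (r2 i0) (r2 i1) (r2 i2) (r2 i3); rewrite sum_ord4 => ? ? ? ? ?.
  by apply: forall_ord4; lra.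
move=> i; case: (normr_pm (rE i)) => e.
  by rewrite (_ : _ - _ = (d i)%:~R) ?intr_int //; lra.
by rewrite (_ : _ - _ = (d i - 1)%:~R) ?intr_int // intrB; lra.
Qed.

Definition quarter : V := row4 4^-1 4^-1 4^-1 4^-1.
Definition quarter' : V := row4 (- 4^-1) 4^-1 4^-1 4^-1.

Lemma odd_quarter x : (forall i, 2 * x 0 i - 2^-1 \is a Num.int) ->
  halfD4 (x - quarter) \/ halfD4 (x - quarter').
Proof.
move=> xi; have /intrP[a ea] := xi i0; have /intrP[b eb] := xi i1.
have /intrP[e ee] := xi i2; have /intrP[f ef] := xi i3.
have int_i (n : int) (t : R) : t = n%:~R -> t \is a Num.int by move=> ->; rewrite intr_int.
case: (boolP (2 %| a + b + e + f)%Z) => /dvdzP.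
  move=> [q eq]; left; split.
    apply: forall_ord4; rewrite !mxE /=.
    - by apply: (int_i a); lra.
    - by apply: (int_i b); lra.
    - by apply: (int_i e); lra.
    - by apply: (int_i f); lra.
  rewrite sum_ord4 !mxE /=.
  have := congr1 (fun n : int => n%:~R : R) eq; rewrite /= !intrD intrM => eq'.
  by apply: (int_i q); lra.
move=> odd; right; have [q eq] : exists q, a + b + e + f = q * 2 + 1.
  exists ((a + b + e + f) %/ 2)%Z.
  case: (boolP (2 %| a + b + e + f)%Z) => [/dvdzP //|].
  by move: (a + b + e + f) => n; lia.
split.
  apply: forall_ord4; rewrite !mxE /=.
  - by apply: (int_i (a + 1)); rewrite intrD; lra.
  - by apply: (int_i b); lra.
  - by apply: (int_i e); lra.
  - by apply: (int_i f); lra.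
rewrite sum_ord4 !mxE /=.
have := congr1 (fun n : int => n%:~R : R) eq; rewrite /= !intrD intrM => eq'.
by apply: (int_i (q + 1)); rewrite intrD; lra.
Qed.

End D4plus.

(** * The minimal vectors of D_4^+/2 *)

Section Quarters.
Variable R : realType.
Local Notation V := 'rV[R]_4.
Implicit Types (x y z w : V) (s : seq V).

Lemma D4E x : D4 R x <->
  (forall i, x 0 i \is a Num.int) /\ 2^-1 * \sum_i x 0 i \is a Num.int.
Proof.
split=> [[z /= /eqP z2 <-]|[xi xs]].
  split=> [i|]; first by rewrite mxE intr_int.
  under eq_bigr do rewrite mxE.
  by rewrite -rmorph_sum; apply: half_int; rewrite eqz_mod_dvd subr0 in z2.
exists (\row_i Num.floor (x 0 i)); last by apply/rowP => i; rewrite !mxE floorK.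
have /intrP[m em] := xs; rewrite /=; apply/eqP; rewrite eqz_mod_dvd subr0.
apply/dvdzP; exists m; apply: (@intr_inj R).
rewrite rmorph_sum /= intrM -em (eq_bigr (fun i => x 0 i)).
  by field.
by move=> i _; rewrite mxE floorK.
Qed.

Lemma half_D4E x : (exists2 d, D4 R d & x = 2^-1 *: d) <-> halfD4 x.
Proof.
have sumZ : \sum_i (2 *: x) 0 i = 2 * \sum_i x 0 i.
  by rewrite mulr_sumr; apply: eq_bigr => i _; rewrite mxE.
have e2 : 2^-1 *: (2 *: x) = x by rewrite scalerA mulVf ?pnatr_eq0 // scale1r.
have D2 : D4 R (2 *: x) <-> halfD4 x.
  rewrite D4E sumZ mulKf ?pnatr_eq0 //; split=> -[h1 h2]; split=> // i.
    by have := h1 i; rewrite mxE.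
  by rewrite mxE.
split=> [[d Dd ex]|hx]; last by exists (2 *: x); [apply/D2 | rewrite e2].
by apply/D2; rewrite ex scalerA mulfV ?pnatr_eq0 // scale1r.
Qed.

Lemma half_D4plusE x : half_D4plus R x <-> halfD4 x \/ halfD4 (x - quarter R).
Proof.
have q2 : 2^-1 *: const_mx 2^-1 = quarter R.
  by apply/rowP; apply: forall_ord4; rewrite row4E !mxE; field.
split=> [[y [Dy|[d Dd <-]] <-]|[/half_D4E[d Dd ->]|/half_D4E[d Dd e]]].
- by left; apply/half_D4E; exists y.
- by right; apply/half_D4E; exists d => //; rewrite scalerDr q2 addrK.
- by exists d => //; left.
- exists (d + const_mx 2^-1); first by right; exists d.
  by rewrite scalerDr q2 -e subrK.
Qed.

Definition qvec (a : (int * int) * (int * int)) : V :=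
  row4 (a.1.1%:~R / 4) (a.1.2%:~R / 4) (a.2.1%:~R / 4) (a.2.2%:~R / 4).

(** The condition on the integer vector a = 4 x under which x lies in D_4^+/2. *)
Definition qcond (a : (int * int) * (int * int)) : bool :=
  [&& (2 %| a.1.2 - a.1.1)%Z, (2 %| a.2.1 - a.1.1)%Z, (2 %| a.2.2 - a.1.1)%Z &
      (4 %| a.1.1 + a.1.2 + a.2.1 + a.2.2)%Z].

Lemma qvec_inj : injective qvec.
Proof.
have q_inj (m n : int) : m%:~R / 4 = n%:~R / 4 :> R -> m = n.
  by move/(mulIf (_ : 4^-1 != 0)) => h; apply: (@intr_inj R); apply: h; rewrite invr_eq0 pnatr_eq0.
by move=> [[a b] [e f]] [[a' b'] [e' f']] /row4_inj[/= /q_inj-> /q_inj-> /q_inj-> /q_inj->].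
Qed.

Lemma half_D4plus_qvec x : half_D4plus R x <-> exists2 a, qcond a & x = qvec a.
Proof.
have int_i (n : int) (t : R) : t = n%:~R -> t \is a Num.int by move=> ->; rewrite intr_int.
rewrite half_D4plusE; split.
  move=> [] [xi]; rewrite sum_ord4 => /intrP[M eM].
    have /intrP[a ea] := xi i0; have /intrP[b eb] := xi i1.
    have /intrP[e ee] := xi i2; have /intrP[f ef] := xi i3.
    exists ((2 * a, 2 * b), (2 * e, 2 * f)).
      apply/and4P; split; rewrite /=; try lia.
      suff -> : 2 * a + 2 * b + 2 * e + 2 * f = M * 4 by rewrite dvdz_mull.
      by apply: (@intr_inj R); rewrite !(intrD, intrM) -ea -eb -ee -ef -eM; ring.
    by rewrite (row4_eta x); congr row4; rewrite /= intrM -?ea -?eb -?ee -?ef; field.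
  have /intrP[a] := xi i0; have /intrP[b] := xi i1.
  have /intrP[e] := xi i2; have /intrP[f] := xi i3.
  move: eM; rewrite !mxE /= => eM ef ee eb ea.
  exists ((2 * a + 1, 2 * b + 1), (2 * e + 1, 2 * f + 1)).
    apply/and4P; split; rewrite /=; try lia.
    suff -> : 2 * a + 1 + (2 * b + 1) + (2 * e + 1) + (2 * f + 1) = (M + 1) * 4.
      by rewrite dvdz_mull.
    by apply: (@intr_inj R); rewrite !(intrD, intrM) -ea -eb -ee -ef -eM; field.
  by rewrite (row4_eta x); congr row4; rewrite /= intrD intrM -?ea -?eb -?ee -?ef; field.
move=> [[[a b] [e f]]]; rewrite /qcond /= => /and4P[ab ae af /dvdzP[M eM]] ->.
have eM' : a%:~R + b%:~R + e%:~R + f%:~R = M%:~R * 4 :> R.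
  by rewrite -!intrD eM intrM.
have half2 (n : int) : (2 %| n)%Z -> exists m, n%:~R = 2 * m%:~R :> R.
  by move=> /dvdzP[q ->]; exists q; rewrite intrM mulrC.
case: (boolP (2 %| a)%Z) => a2.
  have b2 : (2 %| b)%Z by lia.
  have e2 : (2 %| e)%Z by lia.
  have f2 : (2 %| f)%Z by lia.
  have [[a1 A] [b1 B]] := (half2 _ a2, half2 _ b2).
  have [[e1 E] [f1 F]] := (half2 _ e2, half2 _ f2).
  left; split; last by rewrite sum_ord4 !row4E; apply: (int_i M); lra.
  apply: forall_ord4; rewrite row4E; [apply: (int_i a1)|apply: (int_i b1)
    |apply: (int_i e1)|apply: (int_i f1)]; lra.
have a3 : (2 %| a - 1)%Z by lia.
have b2 : (2 %| b - 1)%Z by lia.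
have e2 : (2 %| e - 1)%Z by lia.
have f2 : (2 %| f - 1)%Z by lia.
have [[a1 A] [b1 B]] := (half2 _ a3, half2 _ b2).
have [[e1 E] [f1 F]] := (half2 _ e2, half2 _ f2).
rewrite !intrB in A B E F.
right; split; last first.
  by rewrite sum_ord4 !mxE /=; apply: (int_i (M - 1)); rewrite intrB; lra.
apply: forall_ord4; rewrite !mxE /=; [apply: (int_i a1)|apply: (int_i b1)
    |apply: (int_i e1)|apply: (int_i f1)]; lra.
Qed.

Lemma l1norm_qvec a : l1norm (qvec a) =
  (`|a.1.1| + `|a.1.2| + `|a.2.1| + `|a.2.2|)%:~R / 4.
Proof.
rewrite l1norm_row4 !normrM -!intr_norm (gtr0_norm (_ : 0 < 4^-1)) ?invr_gt0 //.
by rewrite !intrD !mulrDl.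
Qed.

Definition quads : seq ((int * int) * (int * int)) :=
  let I := [:: -4; -3; -2; -1; 0; 1; 2; 3; 4] : seq int in
  let I2 := [seq (a, b) | a <- I, b <- I] in
  [seq p <- [seq (p, q) | p <- I2, q <- I2] | qcond p &&
    (`|p.1.1| + `|p.1.2| + `|p.2.1| + `|p.2.2| == 4)].

Lemma size_quads : size quads = 40%N.
Proof. by vm_compute. Qed.

Lemma uniq_quads : uniq quads.
Proof. by vm_compute. Qed.

Lemma mem_quads a : (a \in quads) =
  qcond a && (`|a.1.1| + `|a.1.2| + `|a.2.1| + `|a.2.2| == 4).
Proof.
rewrite mem_filter; apply: andb_idr; case: a => [[a b] [e f]] /andP[_ /eqP N].
have {}N : `|a| + `|b| + `|e| + `|f| = 4 := N.
have memI (n : int) : `|n| <= 4 -> n \in [:: -4; -3; -2; -1; 0; 1; 2; 3; 4].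
  by case: n => [[|[|[|[|[|n]]]]]|[|[|[|[|n]]]]] //=; lia.
apply: allpairs_f; apply: allpairs_f; apply: memI; lia.
Qed.

Definition short_vectors := map qvec quads.

Lemma unit_vectors_half_D4plus : unit_vectors (half_D4plus R) = [set` short_vectors].
Proof.
apply/seteqP; split => x /=.
  move=> [/half_D4plus_qvec[a ca ->]]; rewrite l1norm_qvec => N.
  rewrite mem_map; last exact: qvec_inj.
  rewrite mem_quads ca /=; apply/eqP/(@intr_inj R).
  by apply: (mulIf (_ : 4^-1 != 0)); rewrite ?invr_eq0 ?pnatr_eq0 // N mulfV // pnatr_eq0.
move=> /mapP[a]; rewrite mem_quads => /andP[ca /eqP N] ->.
split; first by apply/half_D4plus_qvec; exists a.
by rewrite l1norm_qvec N mulfV // pnatr_eq0.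
Qed.

Lemma uniq_short_vectors : uniq short_vectors.
Proof. by rewrite map_inj_uniq ?uniq_quads //; apply: qvec_inj. Qed.

Lemma size_short_vectors : size short_vectors = 40%N.
Proof. by rewrite size_map size_quads. Qed.

Lemma half_D4plus_l1_minimum : is_l1_minimum (half_D4plus R) 1.
Proof.
split.
  have Lx : unit_vectors (half_D4plus R) (qvec ((4, 0), (0, 0))).
    by rewrite unit_vectors_half_D4plus /= mem_map ?mem_quads //; apply: qvec_inj.
  exists (qvec ((4, 0), (0, 0))); case: Lx => Lx Nx; split=> //.
  by apply: contra_eq_neq Nx => ->; rewrite l1norm0 eq_sym oner_eq0.
move=> x /half_D4plus_qvec[[[a b] [e f]] ca ->] x0; rewrite l1norm_qvec /=.
rewrite ler_pdivlMr // mul1r (_ : 4 = 4%:~R) // ler_int.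
have {x0} : ~ [/\ a = 0, b = 0, e = 0 & f = 0].
  by move=> [a0 b0 e0 f0]; move: x0; rewrite a0 b0 e0 f0 /qvec /= mul0r -row4_0 eqxx.
move: ca => /and4P[/= ab ae af abef] n0.
have : ~ (a = 0 /\ b = 0 /\ e = 0 /\ f = 0) by move=> [? [? [? ?]]]; apply: n0.
lia.
Qed.

(** D_4^+ is a rotated copy of Z^4: the rows of half this matrix form an
    orthonormal basis of R^4 that generates D_4^+. *)
Definition hadamard : 'M[R]_4 := \matrix_(i, j)
  nth 0 (nth [::] [:: [:: 1; 1; 1; 1]; [:: 1; 1; -1; -1]; [:: 1; -1; 1; -1]; [:: 1; -1; -1; 1]] i) j.

Lemma half_D4plus_lattice : is_lattice (half_D4plus R).
Proof.
have zB (z : 'rV[int]_4) : map_mx intr z *m (4^-1 *: hadamard) =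
   qvec ((z 0 i0 + z 0 i1 + z 0 i2 + z 0 i3, z 0 i0 + z 0 i1 - z 0 i2 - z 0 i3),
         (z 0 i0 - z 0 i1 + z 0 i2 - z 0 i3, z 0 i0 - z 0 i1 - z 0 i2 + z 0 i3)).
  apply/rowP; apply: forall_ord4; rewrite row4E mxE sum_ord4 !mxE /=;
    by rewrite !(intrD, intrN); ring.
exists (4^-1 *: hadamard).
  suff /mulmx1_unit[] : (4^-1 *: hadamard) *m hadamard = 1%:M by [].
  apply/matrixP; apply: forall_ord4; apply: forall_ord4;
    by rewrite mxE sum_ord4 !mxE /=; field.
apply/seteqP; split => x.
  move=> /half_D4plus_qvec[[[a b] [e f]] /and4P[/=]].
  move=> /dvdzP[p ep] /dvdzP[q eq] /dvdzP[r er] /dvdzP[m em] ->.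
  exists (\row_j nth 0 [:: m; m - a - q - r; m - a - p - r; m - a - p - q] j) => //.
  by rewrite zB !mxE /=; congr (qvec ((_, _), (_, _))); lia.
move=> [z _ <-]; rewrite zB; apply/half_D4plus_qvec.
by eexists; last reflexivity; apply/and4P; split; rewrite /=; lia.
Qed.

End Quarters.

(** * Classification *)

Section Classification.
Variable R : realType.
Local Notation V := 'rV[R]_4.
Implicit Types (x y z w : V) (s : seq V) (L : set V).

Definition flip0 : 'M[R]_4 := diag_mx (row4 (-1) 1 1 1).

Lemma mul_flip0 x : x *m flip0 = row4 (- x 0 i0) (x 0 i1) (x 0 i2) (x 0 i3).
Proof.
apply/rowP; apply: forall_ord4; rewrite row4E mul_mx_diag !mxE /=;
  by rewrite ?mulrN ?mulr1.
Qed.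

Lemma mul_flip0K x : x *m flip0 *m flip0 = x.
Proof. by rewrite !mul_flip0 !row4E opprK -row4_eta. Qed.

Lemma l1norm_flip0 x : l1norm (x *m flip0) = l1norm x.
Proof. by rewrite mul_flip0 l1norm_row4 l1norm4 normrN. Qed.

Definition flip0_set L := [set x *m flip0 | x in L].

Lemma flip0_setE L x : flip0_set L x <-> L (x *m flip0).
Proof.
split=> [[y Ly <-]|Lx]; first by rewrite mul_flip0K.
by exists (x *m flip0) => //; rewrite mul_flip0K.
Qed.

Lemma equivalent_refl L : crosspolytope_equivalent L L.
Proof.
exists 1%:M; split; first by rewrite trmx1 mulmx1.
- by apply/seteqP; split => x; [move=> [y Ky <-]; rewrite mulmx1|exists x; rewrite ?mulmx1].
- by apply/seteqP; split => x; [exists x; rewrite ?mulmx1|move=> [y Ky <-]; rewrite mulmx1].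
Qed.

Lemma equivalent_flip0 L : crosspolytope_equivalent (flip0_set L) L.
Proof.
exists flip0; split => //.
  rewrite tr_diag_mx mulmx_diag -diag_const_mx; congr diag_mx.
  by apply/rowP; apply: forall_ord4; rewrite !mxE /= ?mulrNN mulr1.
by apply/seteqP; split => x;
  rewrite -[[set _ | _ in _]]/(flip0_set _) flip0_setE /crosspolytope /= l1norm_flip0.
Qed.

Lemma halfD4_flip0 x : halfD4 x -> halfD4 (x *m flip0).
Proof.
move=> [xi]; rewrite mul_flip0 sum_ord4 => xs; split.
  by apply: forall_ord4; rewrite row4E // mulrN rpredN.
rewrite sum_ord4 !row4E (_ : _ + _ = x 0 i0 + x 0 i1 + x 0 i2 + x 0 i3 - 2 * x 0 i0).
  by rewrite rpredB.
by ring.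
Qed.

Lemma quarter_flip0 : quarter' R *m flip0 = quarter R.
Proof. by rewrite mul_flip0 !row4E opprK. Qed.

(** If x is in L but not in D_4/2, then x is congruent modulo D_4/2 to
    (1,1,1,1)/4 or to (-1,1,1,1)/4.  Both of these cannot be in L, as they
    differ by (1/2,0,0,0). *)
Lemma classification L c : admissible L c -> contains_halfD4 L ->
  [\/ L = [set x | halfD4 x], L = half_D4plus R | L = flip0_set (half_D4plus R)].
Proof.
move=> adm HL.
have split_L x : L x -> [\/ halfD4 x, L (quarter R) /\ halfD4 (x - quarter R) |
     L (quarter' R) /\ halfD4 (x - quarter' R)].
  move=> Lx; case: (lat_halfD4_or_odd adm HL Lx) => [hx|/odd_quarter[] hx]; first by constructor 1.
    by constructor 2; split=> //; rewrite -[quarter R](subKr x); apply: (latB adm) (HL _ hx).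
  by constructor 3; split=> //; rewrite -[quarter' R](subKr x); apply: (latB adm) (HL _ hx).
have both : L (quarter R) -> L (quarter' R) -> False.
  move=> Lq Lq'; have := lat_small adm (latB adm Lq Lq').
  rewrite row4_lin l1norm_row4 !subrr normr0 opprK !addr0 gtr0_norm; last by rewrite addr_gt0 ?invr_gt0.
  by rewrite row4_0 => /(_ _)/row4_inj[|]; lra.
case: (pselect (L (quarter R))) => [Lq|nq].
  constructor 2; apply/seteqP; split => x; rewrite half_D4plusE.
    by case/split_L => [|[]|[/(both Lq)]]; [left|right|].
  by case=> [/HL //|/HL h]; rewrite -[x](subrK (quarter R)); apply: (latD adm).
case: (pselect (L (quarter' R))) => [Lq|nq'].
  constructor 3; apply/seteqP; split => x; rewrite flip0_setE half_D4plusE.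
    case/split_L => [/halfD4_flip0|[/nq]|[_ /halfD4_flip0]] //; first by left.
    by rewrite mulmxBl quarter_flip0; right.
  case=> /halfD4_flip0; rewrite ?mulmxBl mul_flip0K; first exact: HL.
  by rewrite -quarter_flip0 mul_flip0K => /HL h; rewrite -[x](subrK (quarter' R)); apply: (latD adm).
constructor 1; apply/seteqP; split => x /=; last exact: HL.
by case/split_L => [|[/nq]|[/nq']].
Qed.

Lemma unit_vectors_flip0 L :
  unit_vectors (flip0_set L) = [set x *m flip0 | x in unit_vectors L].
Proof.
rewrite -[RHS]/(flip0_set _); apply/seteqP; split => x; rewrite flip0_setE.
  by move=> [/flip0_setE Lx Nx]; split; rewrite ?l1norm_flip0.
by move=> [Lx]; rewrite l1norm_flip0 => Nx; split=> //; apply/flip0_setE.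
Qed.

Lemma card_unit_vectors_half_D4plus : unit_vectors (half_D4plus R) #= `I_40.
Proof.
have := card_eq_uniq_seq (uniq_short_vectors R) (unit_vectors_half_D4plus R).
by rewrite size_short_vectors.
Qed.

Lemma card_unit_vectors_flip0 L : unit_vectors (flip0_set L) #= unit_vectors L.
Proof.
rewrite unit_vectors_flip0; apply: inj_card_eq => x y _ _ e.
by rewrite -[x]mul_flip0K e mul_flip0K.
Qed.

(** D_4/2 is excluded because its minimal vectors are among those of D_4^+/2,
    without (1,1,1,1)/4. *)
Lemma classification_of_40 L c s : admissible L c -> uniq s ->
  (forall x, x \in s -> unit_vectors L x) -> (39 < size s)%N ->
  L = half_D4plus R \/ L = flip0_set (half_D4plus R).
Proof.
move=> adm us sU s40.
have [s' Fs' s20] := antipode_free_half adm us sU (ltnW s40).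
have HL := contains_halfD4_of_20 adm Fs' s20.
case: (classification adm HL) => eL; [exfalso|by left|by right].
pose q := qvec R ((1, 1), (1, 1)).
have qm : q \in short_vectors R by rewrite mem_map ?mem_quads //; apply: qvec_inj.
have nq : q \notin s.
  apply/negP => /sU[]; rewrite eL => -[/(_ i0)] + _ _.
  rewrite row4E /= mulrA mulr1 => /intrP[m em].
  have : (1 : int) = 2 * m; last by lia.
  by apply: (@intr_inj R); rewrite intrM -em; field.
have : (size (q :: s) <= size (short_vectors R))%N.
  apply: uniq_leq_size; first by rewrite /= nq.
  move=> x; rewrite inE => /orP[/eqP->//|/sU[Lx Nx]].
  have : unit_vectors (half_D4plus R) x.
    by split=> //; apply/half_D4plusE; left; move: Lx; rewrite eL.
  by rewrite unit_vectors_half_D4plus.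
by rewrite size_short_vectors /= ltnNge s40.
Qed.

(** The norm is the gauge of the cross-polytope. *)
Lemma crosspolytope_norm (S : 'M[R]_4) x : S *m S^T = 1%:M ->
  [set x *m S | x in crosspolytope R 4] = crosspolytope R 4 ->
  l1norm (x *m S) = l1norm x.
Proof.
move=> SS SK.
have [->|x0] := eqVneq x 0; first by rewrite mul0mx.
have Sinj : injective (mulmx^~ S : V -> V).
  by move=> y z /(congr1 (mulmx^~ S^T)); rewrite -!mulmxA SS !mulmx1.
have pos y : y != 0 -> 0 < l1norm y.
  move=> y0; rewrite lt_neqAle l1norm_ge0 andbT eq_sym.
  by apply: contra_neq y0; apply: l1norm_eq0.
have xS0 : x *m S != 0.
  by apply: contra_neq x0; rewrite -[RHS](mul0mx _ S); apply: Sinj.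
have nrm y : y != 0 -> l1norm ((l1norm y)^-1 *: y) = 1.
  by move=> y0; rewrite l1normZ gtr0_norm ?invr_gt0 ?pos // mulVf // gt_eqF ?pos.
apply/eqP; rewrite eq_le; apply/andP; split.
  have : crosspolytope R 4 (((l1norm x)^-1 *: x) *m S).
    by rewrite -SK; exists ((l1norm x)^-1 *: x); rewrite //= /crosspolytope /= nrm.
  rewrite /crosspolytope /= -scalemxAl l1normZ gtr0_norm ?invr_gt0 ?pos //.
  by rewrite ler_pdivrMl ?pos // mulr1.
have : crosspolytope R 4 ((l1norm (x *m S))^-1 *: (x *m S)).
  by rewrite /crosspolytope /= nrm.
rewrite -SK => -[y Ky]; rewrite scalemxAl => /Sinj ey.
move: Ky; rewrite /crosspolytope /= ey l1normZ gtr0_norm ?invr_gt0 ?pos //.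
by rewrite ler_pdivrMl ?pos // mulr1.
Qed.

Lemma card_equivalent L1 L2 : crosspolytope_equivalent L1 L2 ->
  unit_vectors L1 #= unit_vectors L2.
Proof.
move=> [S [SS SK ->]].
have -> : unit_vectors [set x *m S | x in L2] = [set x *m S | x in unit_vectors L2].
  apply/seteqP; split => x.
    by move=> [[y Ly <-]]; rewrite crosspolytope_norm // => Ny; exists y.
  by move=> [y [Ly Ny] <-]; split; [exists y | rewrite crosspolytope_norm].
apply: inj_card_eq => y z _ _ /(congr1 (mulmx^~ S^T)).
by rewrite -!mulmxA SS !mulmx1.
Qed.

End Classification.

Theorem theorem2 (R : realType) :
  is_lattice_kissing_number R 4 40 /\
  (forall L : set 'rV[R]_4,
     is_lattice L -> is_l1_minimum L 1 ->
     (unit_vectors L #= `I_40 <-> crosspolytope_equivalent L (half_D4plus R))).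
Proof.
split; first split.
- exists (half_D4plus R); split; [exact: half_D4plus_lattice |
    exact: half_D4plus_l1_minimum | exact: card_unit_vectors_half_D4plus].
- move=> L latL minL; have [c adm] := lattice_admissible latL minL.
  apply: card_le_uniq_seq => s us sU; rewrite leqNgt; apply/negP => s40.
  have UL : unit_vectors L #= `I_40.
    case: (classification_of_40 adm us sU (ltnW s40)) => ->.
      exact: card_unit_vectors_half_D4plus.
    by rewrite (card_eql (card_unit_vectors_flip0 _)) card_unit_vectors_half_D4plus.
  have [s' [us' eU ss']] := card_eq_uniq_seqP UL.
  suff : (size s <= size s')%N by rewrite ss' leqNgt s40.
  by apply: uniq_leq_size => // x /sU; rewrite eU.
- move=> L latL minL; have [c adm] := lattice_admissible latL minL; split.
    move=> /card_eq_uniq_seqP[s [us eU ss]].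
    case: (classification_of_40 adm us (s := s)) => [x xs|||].
    + by rewrite eU.
    + by rewrite ss.
    + by move=> ->; apply: equivalent_refl.
    + by move=> ->; apply: equivalent_flip0.
  move=> /card_equivalent/card_eql ->.
  exact: card_unit_vectors_half_D4plus.
Qed.
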